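(* Let $(M,g)$ be a semi-Riemannian manifold of dimension $n>2$ equipped with a metric connection $\widetilde{\nabla}$, and let $a,b$ be real constants, not both zero, with associated quasi-conformal curvature tensor $\widetilde{\mathcal C}_*$ with respect to $\widetilde{\nabla}$. Then $M$ is $\widetilde{\nabla}$-quasi-conformally flat if and only if one of the following statements is true: (i) $a+(n-2)b=0$, $a\neq 0\neq b$, and $M$ is $\widetilde{\nabla}$-conformally flat; (ii) $a+(n-2)b\neq 0$, $a\neq 0$, and $M$ is $\widetilde{\nabla}$-conformally flat and $\widetilde{\nabla}$-concircularly flat; (iii) $a+(n-2)b\neq 0$, $a=0$, and the Ricci tensor $\widetilde S$ with respect to $\widetilde{\nabla}$ satisfies $\widetilde S-\frac{\widetilde r}{n}\,g=0$, where $\widetilde r$ is the scalar curvature with respect to $\widetilde{\nabla}$.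
   Context: A semi-Riemannian metric $g$ on $M$ is a non-degenerate symmetric $(0,2)$ tensor field. A metric connection $\widetilde{\nabla}$ on $(M,g)$ is a linear connection with $\widetilde{\nabla}g=0$ (torsion is allowed). Its curvature is $\widetilde R(X,Y)Z=\widetilde{\nabla}_X\widetilde{\nabla}_YZ-\widetilde{\nabla}_Y\widetilde{\nabla}_XZ-\widetilde{\nabla}_{[X,Y]}Z$, and $\widetilde R(X,Y,Z,V)=g(\widetilde R(X,Y)Z,V)$. For an orthonormal basis $e_1,\dots,e_n$ with $\varepsilon_i=g(e_i,e_i)$, the Ricci tensor and scalar curvature are $\widetilde S(X,Y)=\sum_i\varepsilon_i\widetilde R(e_i,X,Y,e_i)$ and $\widetilde r=\sum_i\varepsilon_i\widetilde S(e_i,e_i)$. Conformal curvature tensor with respect to $\widetilde{\nabla}$: $$\widetilde{\mathcal C}(X,Y,Z,V)=\widetilde R(X,Y,Z,V)-\tfrac{1}{n-2}\big(\widetilde S(Y,Z)g(X,V)-\widetilde S(X,Z)g(Y,V)+g(Y,Z)\widetilde S(X,V)-g(X,Z)\widetilde S(Y,V)\big)+\tfrac{\widetilde r}{(n-1)(n-2)}\big(g(Y,Z)g(X,V)-g(X,Z)g(Y,V)\big).$$ Concircular curvature tensor with respect to $\widetilde{\nabla}$: $$\widetilde{\mathcal Z}(X,Y,Z,V)=\widetilde R(X,Y,Z,V)-\tfrac{\widetilde r}{n(n-1)}\big(g(Y,Z)g(X,V)-g(X,Z)g(Y,V)\big).$$ Quasi-conformal curvature tensor with respect to $\widetilde{\nabla}$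 (with constants $a,b$): $$\widetilde{\mathcal C}_*(X,Y,Z,V)=a\widetilde R(X,Y,Z,V)+b\big(\widetilde S(Y,Z)g(X,V)-\widetilde S(X,Z)g(Y,V)+g(Y,Z)\widetilde S(X,V)-g(X,Z)\widetilde S(Y,V)\big)-\tfrac{\widetilde r}{n}\Big\{\tfrac{a}{n-1}+2b\Big\}\big(g(Y,Z)g(X,V)-g(X,Z)g(Y,V)\big).$$ $M$ is called $\widetilde{\nabla}$-quasi-conformally flat, $\widetilde{\nabla}$-conformally flat, $\widetilde{\nabla}$-concircularly flat if $\widetilde{\mathcal C}_*=0$, $\widetilde{\mathcal C}=0$, $\widetilde{\mathcal Z}=0$, respectively. *)

(* Defs.v *)
(* Smooth manifolds are given by atlases of charts in R^n,
   vector fields are derivations of the algebra of smooth functions, and tensor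
   fields are multilinear maps over that algebra. *)
From HB Require Import structures.
From mathcomp Require Import all_boot all_order all_algebra.
From mathcomp Require Import ring.
From mathcomp Require Import all_classical all_reals all_analysis.
Set Implicit Arguments.
Unset Strict Implicit.
Unset Printing Implicit Defensive.
Import Order.TTheory GRing.Theory Num.Theory numFieldNormedType.Exports.
Local Open Scope classical_set_scope.
Local Open Scope ring_scope.

Section EuclideanSmoothness.
Variables (R : realType) (n : nat).
Implicit Types (U : set 'rV[R]_n) (f g : 'rV[R]_n -> R).

(* Meaningful for U open, which is the only way it is used. *)
Fixpoint Ck_on (k : nat) U f : Prop :=
  {in U, continuous f} /\
  if k is k'.+1 then
    forall i : 'I_n,
      (forall x, U x -> derivable f x (delta_mx 0 i)) /\
      Ck_on k' U (fun x => 'D_(delta_mx 0 i) f x)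
  else True.

Definition smooth_on U f : Prop := forall k, Ck_on k U f.

Lemma Ck_on_cont k U f : Ck_on k U f -> {in U, continuous f}.
Proof. by case: k => [|k] []. Qed.

Lemma Ck_on_ext k U f g : open U -> (forall x, U x -> f x = g x) ->
  Ck_on k U f -> Ck_on k U g.
Proof.
move=> oU; elim: k f g => [|k IH] f g fg.
  case=> cf _; split=> // x /[!inE] Ux.
  have nfg : \forall y \near x, f y = g y.
    by apply: filterS (open_nbhs_nbhs (conj oU Ux)) => y /fg.
  apply: cvg_trans; first exact: near_eq_cvg nfg.
  by rewrite -fg//; apply: cf; rewrite inE.
have nfg x : U x -> \forall y \near x, f y = g y.
  by move=> Ux; apply: filterS (open_nbhs_nbhs (conj oU Ux)) => y /fg.
case=> cf df; split=> [x /[!inE] Ux|i].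
  apply: cvg_trans; first exact: near_eq_cvg (nfg _ Ux).
  by rewrite -fg//; apply: cf; rewrite inE.
have [ddf kf] := df i; split=> [x Ux|].
  exact: near_eq_derivable (nfg _ Ux) (ddf _ Ux).
apply: IH kf => x Ux; exact: (near_eq_derive _ (nfg _ Ux)).
Qed.

Lemma Ck_onS k U f : Ck_on k.+1 U f -> Ck_on k U f.
Proof.
elim: k f => [|k IH] f [cf df]; first by split.
by split=> // i; have [ddf kf] := df i; split=> //; exact: IH.
Qed.

Lemma Ck_on_cst k U (c : R) : Ck_on k U (cst c).
Proof.
elim: k c => [|k IH] c; first by split=> // x _; exact: cst_continuous.
split=> [x _|i]; first exact: cst_continuous.
split=> [x _|]; first exact: derivable_cst.
rewrite (_ : (fun x => _) = cst 0) //.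
by apply/funext => x; rewrite derive_cst.
Qed.

Lemma Ck_onD k U f g : open U -> Ck_on k U f -> Ck_on k U g ->
  Ck_on k U (f + g).
Proof.
move=> oU; elim: k f g => [|k IH] f g [cf df] [cg dg].
  by split=> // x Ux; exact: cvgD (cf _ Ux) (cg _ Ux).
split=> [x Ux|i]; first exact: cvgD (cf _ Ux) (cg _ Ux).
have [ddf kf] := df i; have [ddg kg] := dg i.
split=> [x Ux|]; first by apply: derivableD; [exact: ddf|exact: ddg].
apply: Ck_on_ext (IH _ _ kf kg) => // x Ux.
by rewrite deriveD//; [exact: ddf|exact: ddg].
Qed.

Lemma Ck_onM k U f g : open U -> Ck_on k U f -> Ck_on k U g ->
  Ck_on k U (f * g).
Proof.
move=> oU; elim: k f g => [|k IH] f g kf kg.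
  split=> // x Ux.
  exact: cvgM (Ck_on_cont kf Ux) (Ck_on_cont kg Ux).
split=> [x Ux|i]; first exact: cvgM (Ck_on_cont kf Ux) (Ck_on_cont kg Ux).
have [_ /(_ i)[ddf kdf]] := kf; have [_ /(_ i)[ddg kdg]] := kg.
split=> [x Ux|]; first by apply: derivableM; [exact: ddf|exact: ddg].
apply: Ck_on_ext (Ck_onD oU (IH _ _ (Ck_onS kf) kdg) (IH _ _ (Ck_onS kg) kdf)) => //.
by move=> x Ux; rewrite deriveM//; [exact: ddf|exact: ddg].
Qed.

End EuclideanSmoothness.

Record chart (R : realType) (n : nat) (M : topologicalType) := Chart {
  chart_dom : set M ;
  chart_map :> M -> 'rV[R]_n ;
  chart_inv : 'rV[R]_n -> M ;
  chart_dom_open : open chart_dom ;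
  chart_cod_open : open (chart_map @` chart_dom) ;
  chart_mapK : {in chart_dom, cancel chart_map chart_inv} ;
  chart_map_cont : {in chart_dom, continuous chart_map} ;
  chart_inv_cont : {in chart_map @` chart_dom, continuous chart_inv} }.

Arguments chart_dom_open {R n M} c.
Arguments chart_cod_open {R n M} c.

(* The atlas need not be maximal: an atlas and the maximal atlas containing it
   have the same smooth functions, hence the same vector fields and tensors. *)
Record manifold (R : realType) (n : nat) := Manifold {
  manifold_sort :> topologicalType ;
  manifold_hausdorff : hausdorff_space manifold_sort ;
  manifold_second_countable : @second_countable manifold_sort ;
  atlas : set (chart R n manifold_sort) ;
  atlas_cover : forall p, exists2 c, atlas c & chart_dom c p ;
  atlas_compatible : forall c d, atlas c -> atlas d -> forall i : 'I_n,
    smooth_on (c @` (chart_dom c `&` chart_dom d))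
              (fun x => d (chart_inv c x) 0 i) }.

Section SmoothFunctions.
Variables (R : realType) (n : nat) (M : manifold R n).

Definition smooth_pred : {pred M -> R} := fun f =>
  `[< forall c, atlas c ->
        smooth_on (c @` chart_dom c) (f \o chart_inv c) >].

Lemma smooth_pred_subring : subring_closed smooth_pred.
Proof.
have sM f g : f \in smooth_pred -> g \in smooth_pred -> f * g \in smooth_pred.
  move=> /asboolP sf /asboolP sg; apply/asboolP => c ac k.
  exact: (Ck_onM (chart_cod_open c) (sf c ac k) (sg c ac k)).
have sC a : cst a \in smooth_pred.
  by apply/asboolP => c ac k; exact: Ck_on_cst.
split=> [|f g sf sg|//]; first exact: sC.
have -> : f - g = f + cst (-1) * g.
  by apply/funext => p; rewrite !fctE mulN1r.
have /asboolP {}sg := sM _ _ (sC (-1)) sg; move/asboolP: sf => sf.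
apply/asboolP => c ac k.
exact: (Ck_onD (chart_cod_open c) (sf c ac k) (sg c ac k)).
Qed.

Lemma smooth_pred_scale (a : R) (f : M -> R) :
  f \in smooth_pred -> a *: f \in smooth_pred.
Proof.
move=> /asboolP sf; apply/asboolP => c ac k.
exact: (Ck_onM (chart_cod_open c) (Ck_on_cst k _ a) (sf c ac k)).
Qed.

HB.instance Definition _ :=
  GRing.isSubringClosed.Build (M -> R) smooth_pred smooth_pred_subring.
HB.instance Definition _ :=
  GRing.isScaleClosed.Build R (M -> R) smooth_pred smooth_pred_scale.

Record smoothFun := SmoothFun {
  smooth_val :> M -> R ;
  smooth_valP : smooth_val \in smooth_pred }.

HB.instance Definition _ := [isSub for smooth_val].
HB.instance Definition _ := [Choice of smoothFun by <:].
HB.instance Definition _ :=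
  GRing.SubChoice_isSubComPzRing.Build _ _ smoothFun smooth_pred_subring.
HB.instance Definition _ := [SubZmodule_isSubLmodule of smoothFun by <:].

End SmoothFunctions.

Lemma smooth_scalerAr (R : realType) (n : nat) (M : manifold R n) (c : R)
  (f h : smoothFun M) : f * (c *: h) = c *: (f * h).
Proof. by apply/val_inj/funext => p; exact: mulrCA. Qed.

Section VectorFields.
Variables (R : realType) (n : nat) (M : manifold R n).
Local Notation F := (smoothFun M).

(* F^o is F as a module over itself; it makes F -> F^o an F-module. *)
Definition derivation_pred : {pred F -> F^o} := fun D : F -> F =>
  `[< (forall (c : R) f h, D (c *: f + h) = c *: D f + D h) /\
      (forall f h, D (f * h) = D f * h + f * D h) >].

Lemma derivation_pred_submod : submod_closed derivation_pred.
Proof.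
split=> [|u D E /asboolP[lD mD] /asboolP[lE mE]]; apply/asboolP.
  split=> [c f h|f h]; rewrite -![(0 : F -> F^o) _]/(0 : F).
    by rewrite scaler0 addr0.
  by rewrite mul0r mulr0 addr0.
have E1 f : (u *: D + E) f = u * D f + E f :> F by [].
split=> [c f h|f h]; rewrite !E1.
  rewrite lD lE mulrDr scalerDr !addrA; congr (_ + _).
  by rewrite smooth_scalerAr addrAC.
rewrite mD mE; ring.
Qed.

HB.instance Definition _ :=
  GRing.isSubmodClosed.Build F (F -> F^o) derivation_pred
    derivation_pred_submod.

Record vectorField := VectorField {
  vf_val :> F -> F^o ;
  vf_valP : vf_val \in derivation_pred }.

HB.instance Definition _ := [isSub for vf_val].
HB.instance Definition _ := [Choice of vectorField by <:].
HB.instance Definition _ := [SubChoice_isSubLmodule of vectorField by <:].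

Lemma lie_bracket_subproof (X Y : vectorField) :
  (fun f : F => X (Y f) - Y (X f)) \in derivation_pred.
Proof.
have /asboolP[lX mX] := vf_valP X; have /asboolP[lY mY] := vf_valP Y.
apply/asboolP; split=> [c f h|f h].
  rewrite !(lX, lY) scalerBr opprD !addrA; congr (_ + _).
  by rewrite addrAC.
have XD a b : X (a + b) = X a + X b :> F by have := lX 1 a b; rewrite !scale1r.
have YD a b : Y (a + b) = Y a + Y b :> F by have := lY 1 a b; rewrite !scale1r.
rewrite mX mY XD YD !mX !mY; ring.
Qed.

Definition lie_bracket X Y := VectorField (lie_bracket_subproof X Y).

End VectorFields.

Section SemiRiemannian.
Variables (R : realType) (n : nat) (M : manifold R n).
Local Notation F := (smoothFun M).
Local Notation VF := (vectorField M).

(* A symmetric (0,2) tensor field, nondegenerate on each tangent space: the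
   value of X at p is the tangent vector f |-> X f p. *)
Record metric := Metric {
  metric_val :> VF -> VF -> F ;
  metric_linear : forall (f : F) X Y Z,
    metric_val (f *: X + Y) Z = f * metric_val X Z + metric_val Y Z ;
  metric_sym : forall X Y, metric_val X Y = metric_val Y X ;
  metric_nondegenerate : forall (p : M) X,
    (forall Y, metric_val X Y p = 0) -> forall f : F, (X f : F) p = 0 }.

Record connection := Connection {
  conn_val :> VF -> VF -> VF ;
  conn_linearl : forall (f : F) X Y Z,
    conn_val (f *: X + Y) Z = f *: conn_val X Z + conn_val Y Z ;
  conn_additiver : forall X Y Z,
    conn_val X (Y + Z) = conn_val X Y + conn_val X Z ;
  conn_leibniz : forall X (f : F) Y,
    conn_val X (f *: Y) = (X f : F) *: Y + f *: conn_val X Y }.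

Definition metric_connection (g : metric) (nabla : connection) : Prop :=
  forall X Y Z : VF, X (g Y Z) = g (nabla X Y) Z + g Y (nabla X Z) :> F.

Definition curvature (nabla : connection) (X Y Z : VF) : VF :=
  nabla X (nabla Y Z) - nabla Y (nabla X Z) - nabla (lie_bracket X Y) Z.

Variables (g : metric) (nabla : connection).

Definition curvature4 (X Y Z V : VF) : F := g (curvature nabla X Y Z) V.

(* Orthonormal bases of the tangent space at p, each basis vector being given
   by a vector field extending it. *)
Definition orthonormal_basis (p : M) (E : 'I_n -> VF) : Prop :=
  [/\ forall i, g (E i) (E i) p = 1 \/ g (E i) (E i) p = -1,
      forall i j, i != j -> g (E i) (E j) p = 0
    & forall X : VF, exists c : 'I_n -> R,
        forall f : F, (X f : F) p = \sum_i c i * (E i f : F) p].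

(* An orthonormal basis exists at every point, and the traces below depend
   neither on the basis nor on the extensions, so any choice will do. *)
Definition frame (p : M) : 'I_n -> VF := xget 0 [set E | orthonormal_basis p E].

Definition causal_sign (p : M) (i : 'I_n) : R := g (frame p i) (frame p i) p.

Definition ricci (X Y : VF) (p : M) : R :=
  \sum_i causal_sign p i * curvature4 (frame p i) X Y (frame p i) p.

Definition scalar_curvature (p : M) : R :=
  \sum_i causal_sign p i * ricci (frame p i) (frame p i) p.

Local Notation S := ricci.
Local Notation r := scalar_curvature.

Definition conformal (X Y Z V : VF) (p : M) : R :=
  curvature4 X Y Z V p
  - (n%:R - 2)^-1 * (S Y Z p * g X V p - S X Z p * g Y V p
                     + g Y Z p * S X V p - g X Z p * S Y V p)
  + r p / ((n%:R - 1) * (n%:R - 2)) * (g Y Z p * g X V p - g X Z p * g Y V p).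

Definition concircular (X Y Z V : VF) (p : M) : R :=
  curvature4 X Y Z V p
  - r p / (n%:R * (n%:R - 1)) * (g Y Z p * g X V p - g X Z p * g Y V p).

Definition quasi_conformal (a b : R) (X Y Z V : VF) (p : M) : R :=
  a * curvature4 X Y Z V p
  + b * (S Y Z p * g X V p - S X Z p * g Y V p
         + g Y Z p * S X V p - g X Z p * S Y V p)
  - r p / n%:R * (a / (n%:R - 1) + 2 * b)
    * (g Y Z p * g X V p - g X Z p * g Y V p).

Definition conformally_flat : Prop :=
  forall X Y Z V p, conformal X Y Z V p = 0.

Definition concircularly_flat : Prop :=
  forall X Y Z V p, concircular X Y Z V p = 0.

Definition quasi_conformally_flat (a b : R) : Prop :=
  forall X Y Z V p, quasi_conformal a b X Y Z V p = 0.

End SemiRiemannian.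

(* Main.v *)
From HB Require Import structures.
Require Import Defs.
From mathcomp Require Import all_boot all_order all_algebra.
From mathcomp Require Import ring lra.
From mathcomp Require Import all_classical all_reals all_analysis.
Set Implicit Arguments.
Unset Strict Implicit.
Unset Printing Implicit Defensive.
Import Order.TTheory GRing.Theory Num.Theory numFieldNormedType.Exports.
Local Open Scope classical_set_scope.
Local Open Scope ring_scope.

(** At every point and for all arguments the three curvature tensors satisfy
      C_* = (a + (n - 2) b) Z - (n - 2) b C
    (quasi_conformalE). If a + (n - 2) b = 0, this says that C_* is a nonzero
    multiple of C. Otherwise, contracting C_* = 0 with an orthonormal basis
    gives (a + (n - 2) b) (S - (r / n) g) = 0, hence S = (r / n) g
    (quasi_conformal_flat_einstein); but then C = Z (conformal_einstein), so
    that C_* = a Z, and what remains depends on whether a vanishes. The converse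
    implications are read off the same two identities.

    The geometry is in the contraction. It needs S(X, Y) and g(X, Y) at p to
    depend only on the values of X and Y at p, whereas both are defined on
    vector fields, that is, on global derivations of the algebra of smooth
    functions. The point is that every map from vector fields to functions
    which is linear over smooth functions kills at p the fields vanishing at p
    (function_linear_vanish), because in a chart x with a bump function psi,
      psi^3 W = sum_i (psi W(psi x_i) - psi x_i W(psi)) (psi d/dx_i)
    for every derivation W (derivation_in_coordinates), and all the
    coefficients vanish at p if W does. This formula is obtained by applying W
    at the point of coordinates q to
      psi^2 u = u(q) psi^2 + sum_i (psi x_i - q_i psi) (psi h_i),
    where u = u(q) + sum_i (x_i - q_i) h_i with smooth h_i is Hadamard's lemma;
    as q varies, the value of h_i at q is always the i-th partial derivative of
    u, whence a formula with smooth coefficients.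

    The analysis behind it is the chain rule for functions of class C^k
    (Ck_on_comp), which makes smoothness independent of the chart, a smooth bump
    function built from exp(-1/t) (exists_bump), and Hadamard's lemma
    (hadamard), whose h_i are averages of partial derivatives along rays.
    Products with a bump function extend by zero outside of the chart
    (chart_extension_smooth), and thus give global functions and fields. *)

(** * Continuously differentiable functions and the chain rule *)

Section Differentiability.
Variables (R : realType).

Lemma is_derive_line (V W : normedModType R) (f : V -> W) (x v : V) (s : R) :
  derivable f (s *: v + x) v ->
  is_derive s 1 (fun t => f (t *: v + x)) ('D_v f (s *: v + x)).
Proof.
have E : (fun h : R => h^-1 *: (f ((h *: 1 + s) *: v + x) - f (s *: v + x))) =
         (fun h => h^-1 *: (f (h *: v + (s *: v + x)) - f (s *: v + x))).
  by apply/funext => h; rewrite [h *: 1]mulr1 scalerDl addrA.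
by move=> df; apply: DeriveDef; rewrite /derivable/derive/= E.
Qed.

Lemma norm_MVT (phi dphi : R -> R) (b e : R) :
  (forall s, `|s| <= `|b| -> is_derive s (1 : R) phi (dphi s) /\ `|dphi s| <= e) ->
  `|phi b - phi 0| <= e * `|b|.
Proof.
move=> H.
have cont u v : `|u| <= `|b| -> `|v| <= `|b| ->
    {within `[u, v], continuous phi}.
  move=> ub vb; apply: derivable_within_continuous => s.
  rewrite in_itv /= => /andP[us sv]; have [//|[]//] := H s.
  by move: ub vb; rewrite !ler_norml => /andP[? ?] /andP[? ?]; apply/andP; lra.
have main u v : u <= v -> `|u| <= `|b| -> `|v| <= `|b| ->
    `|phi v - phi u| <= e * `|v - u|.
  move=> uv ub vb.
  have sb s : u <= s <= v -> `|s| <= `|b|.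
    move=> /andP[us sv].
    by move: ub vb; rewrite !ler_norml => /andP[? ?] /andP[? ?]; apply/andP; lra.
  have dphiP s : s \in `]u, v[%R -> is_derive s (1 : R) phi (dphi s).
    rewrite in_itv /= => /andP[us sv].
    have [|//] := H s; apply: sb; rewrite !ltW//.
  have [c cuv ->] := MVT_segment uv dphiP (cont _ _ ub vb).
  by rewrite normrM ler_wpM2r//; have [] := H c (sb c cuv).
have [b0|b0] := leP 0 b.
  by have := main 0 b b0; rewrite normr0 subr0; apply.
by have := main b 0 (ltW b0); rewrite sub0r normrN distrC normr0; apply.
Qed.

End Differentiability.

Section ContinuouslyDifferentiable.
Variables (R : realType) (n : nat).
Local Notation e_ i := (delta_mx 0 i : 'rV[R]_n).
Implicit Types (U : set 'rV[R]_n) (f : 'rV[R]_n -> R).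

(** The increment f(x + h) - f(x) is the sum of n increments along the
    coordinate axes, each of them controlled by the mean value theorem and the
    continuity of one partial derivative. *)
Lemma Ck_on_1_littleo U f x : open U -> Ck_on 1 U f -> U x ->
  forall e, 0 < e -> \forall h \near (0 : 'rV[R]_n),
    `|f (h + x) - (f x + \sum_i h 0 i * 'D_(e_ i) f x)| <= e * `|h|.
Proof.
move=> oU [_ df] Ux e e0.
(* The n coordinate increments each contribute at most e' |h|, and n.+1
   rather than n keeps the denominator nonzero when n = 0. *)
pose e' := e / n.+1%:R.
have e'0 : 0 < e' by rewrite divr_gt0.
have nD (i : 'I_n) : \forall y \near x, `|'D_(e_ i) f y - 'D_(e_ i) f x| <= e'.
  have [_ [cDf _]] := df i.
  have /cvgrPdist_le/(_ _ e'0) := cDf x (mem_set Ux).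
  by apply: filterS => y; rewrite distrC.
have nU : \forall y \near x, U y by exact: open_nbhs_nbhs.
have /nbhs_ballP[d /= d0 Hd] : nbhs x (U `&` [set y | forall i : 'I_n,
    `|'D_(e_ i) f y - 'D_(e_ i) f x| <= e']).
  by apply: filterI => //; apply: filter_forall nD.
have {}Hd y : `|y| < d -> U (y + x) /\ forall i : 'I_n,
     `|'D_(e_ i) f (y + x) - 'D_(e_ i) f x| <= e'.
  by move=> yd; apply: Hd; rewrite -ball_normE /= opprD addrCA subrr addr0 normrN.
have coordle (y : 'rV[R]_n) i : `|y 0 i| <= `|y|.
  by rewrite [leRHS]/Num.Def.normr/= mx_normrE; apply: (le_bigmax _ _ (0, i)).
near=> h.
have hd : `|h| < d by near: h; exact: (@nbhs0_lt R 'rV[R]_n d d0).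
(* Increments restricted to the first k coordinates, from 0 to h. *)
pose w (k : nat) : 'rV[R]_n := \row_j (if (j < k)%N then h 0 j else 0).
have wS (i : 'I_n) : w i.+1 = h 0 i *: e_ i + w i.
  apply/rowP => j; rewrite !mxE ltnS eqxx /=.
  have [->|ij] := eqVneq j i; first by rewrite leqnn ltnn mulr1 addr0.
  by rewrite mulr0 add0r leq_eqVlt val_eqE (negPf ij).
have wle (k : nat) (i : 'I_n) s : (i = k :> nat) -> `|s| <= `|h 0 i| ->
    `|s *: e_ i + w k| <= `|h|.
  move=> ik sh; rewrite [leLHS]/Num.Def.normr/= mx_normrE bigmax_le// => -[a j] _.
  rewrite !mxE ord1 eqxx /=; have [->|ji] := eqVneq j i.
    by rewrite mulr1 ik ltnn addr0 (le_trans sh).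
  by rewrite mulr0 add0r; case: ifP; rewrite ?normr0.
have -> : f (h + x) - (f x + \sum_i h 0 i * 'D_(e_ i) f x) =
    \sum_(i < n) ((f (w i.+1 + x) - f (w i + x)) - h 0 i * 'D_(e_ i) f x).
  rewrite sumrB -(big_mkord xpredT (fun i => f (w i.+1 + x) - f (w i + x))).
  rewrite telescope_sumr//.
  have -> : w n = h by apply/rowP => j; rewrite mxE ltn_ord.
  have -> : w 0%N = 0 by apply/rowP => j; rewrite !mxE.
  by rewrite add0r opprD addrA.
have step (i : 'I_n) :
    `|(f (w i.+1 + x) - f (w i + x)) - h 0 i * 'D_(e_ i) f x| <= e' * `|h|.
  pose a := 'D_(e_ i) f x.
  pose phi s := f (s *: e_ i + (w i + x)) - s * a.
  pose dphi s := 'D_(e_ i) f (s *: e_ i + (w i + x)) - a.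
  have -> : f (w i.+1 + x) - f (w i + x) - h 0 i * a = phi (h 0 i) - phi 0.
    by rewrite /phi wS scale0r add0r mul0r subr0 addrAC addrA.
  apply: (@le_trans _ _ (e' * `|h 0 i|)); last by rewrite ler_wpM2l ?coordle ?(ltW e'0).
  apply: (@norm_MVT _ _ dphi) => s sh.
  have := Hd (s *: e_ i + w i); rewrite -addrA => -[|Us Ds].
    exact: le_lt_trans (wle _ _ _ erefl sh) hd.
  split; last exact: Ds.
  rewrite /phi /dphi; apply: is_deriveB; last first.
    have := is_deriveM (is_derive_id s 1) (is_derive_cst a s 1).
    by rewrite scaler0 add0r [_ *: _]mulr1.
  by apply: is_derive_line; have [dfi _] := df i; exact: dfi.
rewrite (le_trans (ler_norm_sum _ _ _))// (le_trans (ler_sum _ (fun i _ => step i)))//.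
rewrite sumr_const card_ord -mulr_natl /e'.
rewrite mulrA ler_wpM2r// mulrC -mulrA ler_piMr ?ltW//.
by rewrite mulrC ltr_pdivrMr// mul1r ltr_nat.
Unshelve. all: by end_near.
Qed.

Definition linear_form (a : 'I_n -> R) (h : 'rV[R]_n) : R := \sum_i h 0 i * a i.

Lemma linear_form_is_linear a : linear (linear_form a : 'rV[R]_n -> R^o).
Proof.
move=> k u v; rewrite /linear_form scaler_sumr -big_split /=.
by apply: eq_bigr => i _; rewrite !mxE mulrDl -mulrA.
Qed.

HB.instance Definition _ a := GRing.isLinear.Build R 'rV[R]_n R^o *:%R
  (linear_form a) (linear_form_is_linear a).

Lemma Ck_on_1_is_diff U f x : open U -> Ck_on 1 U f -> U x ->
  is_diff x f (linear_form (fun i => 'D_(e_ i) f x)).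
Proof.
move=> oU kf Ux; set df := linear_form _.
have cdf : continuous df.
  rewrite /df /linear_form => y; elim: (index_enum _) => [|i s IHs].
    rewrite (_ : (fun h => _) = cst 0); first exact: cst_continuous.
    by apply/funext => h; rewrite big_nil.
  rewrite (_ : (fun h : 'rV[R]_n => _) = (fun h : 'rV[R]_n => h 0 i * 'D_(e_ i) f x) \+
    (fun h : 'rV[R]_n => \sum_(j <- s) h 0 j * 'D_(e_ j) f x)); last first.
    by apply/funext => h; rewrite big_cons.
  apply: (@cvgD _ _ _ _ _ _ _ _ _ _ IHs).
  by apply: cvgM; [exact: coord_continuous|exact: cvg_cst].
have E : f \o shift x = cst (f x) + df +o_ (0 : 'rV[R]_n) id.
  apply/eqaddoP => e e0.
  exact: (Ck_on_1_littleo oU kf Ux e0).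
have dE := diff_unique cdf E.
apply: DiffDef; last exact: dE.
by apply/diff_locallyP; rewrite dE.
Qed.

(** Directional derivatives alone do not compose; f does have a differential,
    by Ck_on_1_is_diff, and only the restriction of c to the line through y in
    the direction v matters, which reduces to a curve. *)
Lemma is_derive_comp_Ck_on_1 (V : normedModType R) (c : V -> 'rV[R]_n) U f y v dc :
  open U -> Ck_on 1 U f -> U (c y) -> is_derive y v c dc ->
  is_derive y v (f \o c) (\sum_i dc 0 i * 'D_(e_ i) f (c y)).
Proof.
move=> oU kf Uy [dcy dcE].
have cy0 : c (0 *: v + y) = c y by rewrite scale0r add0r.
have dl : is_derive (0 : R) 1 (fun t : R => c (t *: v + y)) dc.
  rewrite -dcE -[in 'D_v c y](add0r y) -(scale0r v).
  by apply: is_derive_line; rewrite scale0r add0r.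
have d1 : differentiable (fun t : R => c (t *: v + y)) 0.
  by apply/derivable1_diffP; case: dl.
have df : is_diff (c (0 *: v + y)) f (linear_form (fun i => 'D_(e_ i) f (c y))).
  by rewrite cy0; exact: Ck_on_1_is_diff kf Uy.
have dfc : differentiable (f \o (fun t : R => c (t *: v + y))) 0.
  by apply: differentiable_comp => //; case: df.
have dd : derivable (f \o c) y v.
  by apply/derivable1P; apply/derivable1_diffP.
apply: DeriveDef => //.
transitivity ('D_1 (f \o (fun t : R => c (t *: v + y))) 0).
  have [_ /= ->] : is_derive (0 : R) 1 (fun t : R => f (c (t *: v + y)))
      ('D_v (f \o c) (0 *: v + y)).
    by apply: (@is_derive_line R V R^o (f \o c)); rewrite scale0r add0r.
  by rewrite scale0r add0r.
rewrite deriveE// diff_comp//.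
rewrite /= diff_val -deriveE//; case: dl => _ ->.
by [].
Qed.

End ContinuouslyDifferentiable.

Section DifferentiabilityClasses.
Variables (R : realType) (n : nat).
Local Notation e_ i := (delta_mx 0 i : 'rV[R]_n).
Implicit Types (U V : set 'rV[R]_n) (f : 'rV[R]_n -> R).

Lemma Ck_on_le k l U f : (l <= k)%N -> Ck_on k U f -> Ck_on l U f.
Proof.
move=> /subnK <-; elim: (k - l)%N => [//|d IHd].
by rewrite addSn => /Ck_onS.
Qed.

(** Continuity and the existence of partial derivatives are local, and the
    partial derivatives themselves do not depend on the open set. *)
Lemma Ck_on_local k U f :
  (forall x, U x -> exists2 V, V x & Ck_on k V f) -> Ck_on k U f.
Proof.
elim: k f => [|k IHk] f H.
  by split=> // x /set_mem /H[V Vx [cf _]]; apply: cf; rewrite inE.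
split=> [x /set_mem /H[V Vx [cf _]]|i]; first by apply: cf; rewrite inE.
split=> [x /H[V Vx [_ /(_ i)[df _]]]|]; first exact: df.
by apply: IHk => x /H[V Vx [_ /(_ i)[_ kf]]]; exists V.
Qed.

Lemma Ck_onW k U V f : V `<=` U -> Ck_on k U f -> Ck_on k V f.
Proof. by move=> VU kf; apply: Ck_on_local => x /VU Ux; exists U. Qed.

Lemma Ck_on_sum k U (I : Type) (s : seq I) (F : I -> 'rV[R]_n -> R) :
  open U -> (forall i, Ck_on k U (F i)) ->
  Ck_on k U (fun x => \sum_(i <- s) F i x).
Proof.
move=> oU kF; elim: s => [|i s IHs].
  rewrite (_ : (fun x => _) = cst 0); first exact: Ck_on_cst.
  by apply/funext => x; rewrite big_nil.
rewrite (_ : (fun x => _) = F i + (fun x => \sum_(j <- s) F j x)).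
  exact: Ck_onD.
by apply/funext => x; rewrite big_cons.
Qed.

Lemma is_derive_coord (x v : 'rV[R]_n) i :
  is_derive x v (fun y : 'rV[R]_n => y 0 i) (v 0 i).
Proof.
have [dx dxE] := is_derive_id x v.
have /derivable_mxP/(_ 0 i) dxi := dx.
by apply: DeriveDef => //; rewrite -[in RHS]dxE derive_mx// mxE.
Qed.

Lemma Ck_on_coord k U (i : 'I_n) : Ck_on k U (fun x => x 0 i).
Proof.
case: k => [|k]; first by split=> // x _; exact: coord_continuous.
split=> [x _|j]; first exact: coord_continuous.
split=> [x _|]; first by case: (is_derive_coord x (e_ j) i).
rewrite (_ : (fun x => _) = cst (e_ j 0 i)); first exact: Ck_on_cst.
by apply/funext => x; case: (is_derive_coord x (e_ j) i).
Qed.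

End DifferentiabilityClasses.

Lemma continuous_rowP (R : realType) (n : nat) (T : topologicalType)
    (c : T -> 'rV[R]_n) x :
  (forall j, {for x, continuous (fun y => c y 0 j)}) -> {for x, continuous c}.
Proof.
move=> cc; apply/cvgrPdist_le => e e0.
have H (j : 'I_n) : \forall y \near x, `|c x 0 j - c y 0 j| <= e.
  by have /cvgrPdist_le/(_ _ e0) := cc j.
apply: filterS (filter_forall _ H) => y Hy.
rewrite [leLHS]/Num.Def.normr/= mx_normrE bigmax_le ?(ltW e0)// => -[a j] _.
by rewrite !mxE ord1; exact: Hy.
Qed.

(** By induction on k: the partial derivatives of f o c are sums of products
    of partial derivatives of c and of partial derivatives of f composed with
    c, to which the induction hypothesis applies. *)
Lemma Ck_on_comp (R : realType) (m n k : nat) (U : set 'rV[R]_m)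
    (V : set 'rV[R]_n) (f : 'rV[R]_n -> R) (c : 'rV[R]_m -> 'rV[R]_n) :
  open U -> open V -> (forall x, U x -> V (c x)) ->
  (forall j, Ck_on k U (fun x => c x 0 j)) -> Ck_on k V f ->
  Ck_on k U (f \o c).
Proof.
move=> oU oV UV; have cfc l f' : (forall j, Ck_on l U (fun x => c x 0 j)) -> Ck_on l V f' ->
    {in U, continuous (f' \o c)}.
  move=> kc kf x /[dup] xU /set_mem /UV Vcx; apply: continuous_comp.
    by apply: continuous_rowP => j; exact: Ck_on_cont (kc j) _ xU.
  by apply: (Ck_on_cont kf); rewrite inE.
elim: k f => [|k IHk] f kc kf; first by split=> //; exact: cfc kc kf.
split=> [|i]; first exact: cfc kc kf.
have chain x : U x -> is_derive x (delta_mx 0 i) (f \o c)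
   (\sum_j 'D_(delta_mx 0 i) (fun x => c x 0 j) x * 'D_(delta_mx 0 j) f (c x)).
  move=> Ux.
  have dc : derivable c x (delta_mx 0 i).
    apply/derivable_mxP => a j; rewrite ord1.
    by have [_ /(_ i)[dc _]] := kc j; exact: dc.
  have [d dE] := is_derive_comp_Ck_on_1 oV (Ck_on_le (ltn0Sn k) kf) (UV _ Ux)
    (derivableP dc).
  apply: DeriveDef => //; rewrite dE; apply: eq_bigr => j _.
  by rewrite derive_mx// mxE.
split=> [x /chain[]//|].
apply: (Ck_on_ext oU) (Ck_on_sum (index_enum 'I_n) oU _) => /=.
  by move=> x Ux; have [_ ->] := chain x Ux.
move=> j; apply: (Ck_onM oU).
  by have [_ /(_ i)[_ kDc]] := kc j.
apply: (IHk ('D_(delta_mx 0 j) f)); first by move=> l; exact: Ck_onS.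
by have [_ /(_ j)[_ kDf]] := kf.
Qed.

(** * Smooth bump functions *)

Section FlatFunction.
Variable R : realType.

(** All derivatives of exp(-1/t), extended by 0, are linear combinations of
    these functions. As the span of the family is closed under derivation,
    smoothness is a simple induction. *)
Definition flat (m : nat) (t : R) : R :=
  if 0 < t then t ^- m * expR (- t^-1) else 0.

Lemma flat_ge0 m t : 0 <= flat m t.
Proof.
by rewrite /flat; case: ifP => // t0; rewrite mulr_ge0 ?expR_ge0 ?invr_ge0 ?exprn_ge0 ?ltW.
Qed.

Lemma flatS m t : flat m t = flat m.+1 t * t.
Proof.
rewrite /flat; case: ifP => [t0|_]; last by rewrite mul0r.
by rewrite exprS invfM [RHS]mulrC !mulrA mulfV ?mul1r// gt_eqF.
Qed.

(** From exp(s) >= s^(m+1)/(m+1)! with s = 1/t. This is what makes every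
    difference quotient of the family at 0 tend to 0. *)
Lemma flat_le m t : flat m t <= (m.+1)`!%:R * `|t|.
Proof.
have [t0|t0] := leP t 0; first by rewrite /flat ltNge t0/= mulr_ge0.
rewrite flatS gtr0_norm// ler_wpM2r ?(ltW t0)// /flat t0.
rewrite expRN -exprVn ler_pdivrMr ?expR_gt0//.
rewrite -ler_pdivrMl ?ltr0n ?fact_gt0//.
have := @expR_ge1Dxn _ t^-1 m; rewrite invr_ge0 ltW// => /(_ isT).
by rewrite mulrC; apply: le_trans; rewrite lerDr.
Qed.

Lemma is_derive_flat m (t : R) :
  is_derive t (1 : R) (flat m) (flat m.+2 t - m%:R * flat m.+1 t).
Proof.
have [t0|t0|->] := ltgtP t 0.
- have -> : flat m.+2 t - m%:R * flat m.+1 t = 0.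
    by rewrite /flat ltNge (ltW t0)/= mulr0 subr0.
  apply: (near_eq_is_derive _ (is_derive_cst (0 : R) t (1 : R))).
  near=> s; rewrite /flat ltNge (_ : s <= 0)//.
  by near: s; by apply: filterS (lt_nbhsl t0) => y /ltW.
- have tn0 : t != 0 by rewrite gt_eqF.
  have -> : flat m.+2 t - m%:R * flat m.+1 t =
      (m%:R * t^-1 ^+ m.-1 * expR (- t^-1) - t^-1 ^+ m * expR (- t^-1))
      * (- t^-2).
    rewrite /flat t0 -!exprVn; case: m => [|m] /=; first by ring.
    by rewrite !exprS; ring.
  have dV : is_derive t (1 : R) (@GRing.inv R) (- t^-2).
    have := is_deriveV tn0 (is_derive_id t (1 : R)).
    by move=> H; apply: (is_derive_eq H); rewrite /GRing.scale /= mulr1.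
  have dp : is_derive t^-1 (1 : R) (fun v : R => v ^+ m * expR (- v))
      (m%:R * t^-1 ^+ m.-1 * expR (- t^-1) - t^-1 ^+ m * expR (- t^-1)).
    have dN : is_derive t^-1 (1 : R) (-%R : R -> R) (-1).
      exact: is_deriveNid.
    have dE := @is_derive1_comp _ _ _ _ _ _ (is_derive_expR (- t^-1)) dN.
    have dX : is_derive t^-1 (1 : R) (fun v : R => v ^+ m) (m%:R * t^-1 ^+ m.-1).
      by apply: DeriveDef; [exact: exprn_derivable|rewrite exp_derive [_ *: _]mulr1].
    by apply: (is_derive_eq (is_deriveM dX dE)); rewrite /GRing.scale /=; ring.
  have := @is_derive1_comp _ _ _ _ _ _ dp dV.
  apply: near_eq_is_derive.
  near=> s; rewrite /flat /= exprVn ifT//.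
  by near: s; exact: lt_nbhsr.
- have -> : flat m.+2 0 - m%:R * flat m.+1 0 = 0.
    by rewrite /flat ltxx mulr0 subr0.
  have H : h^-1 *: (flat m (h *: 1 + 0) - flat m 0) @[h --> 0^'] --> (0 : R).
    apply/cvgrPdist_le => e e0.
    near=> h.
    have h0 : h != 0 by near: h; exact: nbhs_dnbhs_neq.
    rewrite sub0r normrN [flat m 0]/flat ltxx subr0 addr0 [h *: 1]mulr1.
    rewrite flatS [_ *: _]mulrC mulfK// ger0_norm ?flat_ge0//.
    rewrite (le_trans (flat_le _ _))// mulrC -ler_pdivlMr ?ltr0n ?fact_gt0//.
    near: h; apply: dnbhs0_le; rewrite divr_gt0// ltr0n fact_gt0//.
  apply: DeriveDef; last exact/cvg_lim.
  by apply/cvg_ex; exists 0.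
Unshelve. all: by end_near.
Qed.

End FlatFunction.

Lemma is_derive_comp1 (R : realType) (V : normedModType R) (phi : R -> R)
    (u : V -> R) x v du dphi :
  is_derive (u x) (1 : R) phi dphi -> is_derive x v u du ->
  is_derive x v (phi \o u) (dphi * du).
Proof.
move=> dp [dux duE].
have ux0 : u (0 *: v + x) = u x by rewrite scale0r add0r.
have dl : is_derive (0 : R) 1 (fun t : R => u (t *: v + x)) du.
  rewrite -duE -[in 'D_v u x](add0r x) -(scale0r v).
  by apply: (@is_derive_line R V R^o u); rewrite scale0r add0r.
have dp' : is_derive (u (0 *: v + x)) 1 phi dphi by rewrite ux0.
have [d dE] := @is_derive1_comp _ _ _ _ _ _ dp' dl.
have dd : derivable (phi \o u) x v by apply/derivable1P.
apply: DeriveDef => //.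
have [_ /= dE'] : is_derive (0 : R) 1 (fun t : R => phi (u (t *: v + x)))
      ('D_v (phi \o u) (0 *: v + x)).
    by apply: (@is_derive_line R V R^o (phi \o u)); rewrite scale0r add0r.
by rewrite -[in LHS](add0r x) -(scale0r v) -dE' dE.
Qed.

Lemma Ck_on_flat (R : realType) n k m (U : set 'rV[R]_n) (u : 'rV[R]_n -> R) :
  open U -> Ck_on k U u -> Ck_on k U (flat m \o u).
Proof.
move=> oU; elim: k m => [|k IHk] m ku.
  split=> // x Ux; apply: continuous_comp; first by case: ku => cu _; exact: cu.
  apply: differentiable_continuous; apply/derivable1_diffP.
  by case: (is_derive_flat m (u x)).
split=> [x Ux|i].
  apply: continuous_comp; first by case: ku => cu _; exact: cu.
  apply: differentiable_continuous; apply/derivable1_diffP.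
  by case: (is_derive_flat m (u x)).
have chain x : U x -> is_derive x (delta_mx 0 i) (flat m \o u)
   ((flat m.+2 (u x) - m%:R * flat m.+1 (u x)) * 'D_(delta_mx 0 i) u x).
  move=> Ux; apply: is_derive_comp1; first exact: is_derive_flat.
  by apply/derivableP; have [_ /(_ i)[du _]] := ku; exact: du.
split=> [x /chain[]//|].
have ku' := Ck_onS ku.
have [_ /(_ i)[_ kD]] := ku.
have kM : Ck_on k U
  (((flat m.+2 \o u) + cst (- m%:R) * (flat m.+1 \o u)) * 'D_(delta_mx 0 i) u).
  apply: (Ck_onM oU) => //; apply: (Ck_onD oU); first exact: IHk.
  by apply: (Ck_onM oU); [exact: Ck_on_cst|exact: IHk].
apply: (Ck_on_ext oU) kM => x Ux; have [_ ->] := chain x Ux.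
by rewrite !fctE /= mulNr.
Qed.

(** The Euclidean distance makes psi smooth, and it dominates the norm of
    row vectors, which is the maximum of the coordinates. *)
Lemma exists_bump (R : realType) (n : nat) (x0 : 'rV[R]_n) (r : R) : 0 < r ->
  exists psi : 'rV[R]_n -> R, [/\ smooth_on setT psi, 0 < psi x0
    & forall x, r <= `|x - x0| -> psi x = 0].
Proof.
move=> r0.
pose q (x : 'rV[R]_n) := \sum_i (x 0 i - x0 0 i) ^+ 2.
pose psi x := flat 0 (r ^+ 2 - q x).
exists psi; split.
- move=> k; apply: (@Ck_on_flat R n k 0 setT (fun x => r ^+ 2 - q x)).
    exact: openT.
  have kc i : Ck_on k setT (fun x : 'rV[R]_n => x 0 i - x0 0 i).
    apply: (@Ck_onD R n k setT (fun x => x 0 i) (cst (- x0 0 i))).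
    - exact: openT.
    - exact: Ck_on_coord.
    - exact: Ck_on_cst.
  have kq : Ck_on k setT q.
    apply: Ck_on_sum; first exact: openT.
    by move=> i; apply: (Ck_onM openT (kc i) (kc i)).
  have kNq := Ck_onM openT (Ck_on_cst k setT (-1)) kq.
  apply: (Ck_on_ext openT) (Ck_onD openT (Ck_on_cst k setT (r ^+ 2)) kNq).
  by move=> x _; rewrite !fctE mulN1r.
- rewrite /psi /flat (_ : q x0 = 0) ?subr0 ?exprn_gt0//; last first.
    by rewrite /q big1// => i _; rewrite subrr expr0n.
  by rewrite expr0 invr1 mul1r expR_gt0.
- move=> x rx; rewrite /psi /flat subr_gt0 ifN//.
  apply: contraL rx => qr; rewrite -ltNge.
  rewrite [ltLHS]/Num.Def.normr/= mx_normrE bigmax_lt// => -[a j] _.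
  rewrite !mxE ord1 -(ltr_pXn2r (ltn0Sn 1)) ?nnegrE ?normr_ge0 ?(ltW r0)//.
  rewrite real_normK ?num_real//; apply: le_lt_trans qr.
  by rewrite /q (bigD1 j)//= lerDl sumr_ge0// => i _; rewrite sqr_ge0.
Qed.

(** * Hadamard's lemma *)

Lemma continuous_distP (R : realType) (T : topologicalType) (f : T -> R) x :
  (forall e, 0 < e -> \forall y \near x, `|f x - f y| <= e) ->
  {for x, continuous f}.
Proof. by move=> H; apply/cvgrPdist_le. Qed.

Lemma Rintegral_unit_cst (R : realType) (c : R) :
  \int[@lebesgue_measure R]_(t in `[0, 1]) c = c.
Proof.
have E := @lebesgue_measure_itv R `[0, 1]%R. 
rewrite Rintegral_cst// [X in fine X](_ : _ = 1%E) ?mulr1//; rewrite [LHS]E /=.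
by rewrite lte_fin ltr01 oppr0 adde0.
Qed.

Lemma Rintegral_unit_sum (R : realType) (I : Type) (s : seq I) (a : I -> R)
    (G : I -> R -> R) :
  (forall i, {within `[0, 1]%classic, continuous (G i)}) ->
  {within `[0, 1]%classic, continuous (fun t => \sum_(i <- s) a i * G i t)} /\
  \int[@lebesgue_measure R]_(t in `[0, 1]) (\sum_(i <- s) a i * G i t) =
    \sum_(i <- s) a i * \int[@lebesgue_measure R]_(t in `[0, 1]) G i t.
Proof.
move=> cG.
have int (g : R -> R) : {within `[0, 1]%classic, continuous g} ->
    (@lebesgue_measure R).-integrable `[0, 1]%classic (EFin \o g).
  by move=> cg; apply: continuous_compact_integrable => //; exact: segment_compact.
elim: s => [|i s [cS intS]].
  have -> : (fun t => \sum_(i <- [::]) a i * G i t) = cst 0.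
    by apply/funext => t; rewrite big_nil.
  by split; [move=> t; exact: cst_continuous|rewrite Rintegral_unit_cst big_nil].
have -> : (fun t => \sum_(j <- i :: s) a j * G j t) =
    (fun t => a i * G i t) \+ (fun t => \sum_(j <- s) a j * G j t).
  by apply/funext => t; rewrite big_cons.
have cl : {within `[0, 1]%classic, continuous (fun t => a i * G i t)}.
  by move=> t; apply: cvgM; [exact: cvg_cst|exact: cG].
split; first by move=> t; exact: cvgD (cl t) (cS t).
rewrite big_cons -intS -RintegralZl//; last exact: int.
by rewrite -RintegralD//; exact: int.
Qed.

Section Hadamard.
Variables (R : realType) (n : nat) (q : 'rV[R]_n).
Local Notation e_ i := (delta_mx 0 i : 'rV[R]_n).
Local Notation mu := (@lebesgue_measure R).

Definition ray (t : R) (x : 'rV[R]_n) : 'rV[R]_n := q + t *: (x - q).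

Lemma ray_continuous (t : R) x :
  ray z.1 z.2 @[z --> (t, x)] --> ray t x.
Proof.
apply: cvgD; first exact: cvg_cst.
apply: cvgZ; first exact: cvg_fst.
by apply: cvgB; [exact: cvg_snd|exact: cvg_cst].
Qed.

Definition star_shaped (V : set 'rV[R]_n) :=
  forall t x, `[0, 1]%classic t -> V x -> V (ray t x).

Variable V : set 'rV[R]_n.
Hypothesis starV : star_shaped V.
Implicit Types (u : 'rV[R]_n -> R).

(** Compactness of [0, 1] turns joint continuity in (t, x) into continuity in
    x uniformly in t. *)
Lemma ray_uniform u x e : {in V, continuous u} -> V x -> 0 < e ->
  \forall y \near x, forall t, `[0, 1]%classic t ->
    `|u (ray t y) - u (ray t x)| <= e.
Proof.
move=> cu Vx e0.
have := @segment_compact R 0 1.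
move=> /compact_near_coveringP.
move=> /(_ _ (nbhs x) (fun y t => `|u (ray t y) - u (ray t x)| <= e)); apply.
move=> t t01.
have e20 : 0 < e / 2 by rewrite divr_gt0.
have cur : u (ray z.1 z.2) @[z --> (t, x)] --> u (ray t x).
  apply: (cvg_comp _ _ (@ray_continuous t x)).
  by apply: cu; rewrite inE; exact: starV.
have Nz : \forall z \near (t, x), `|u (ray t x) - u (ray z.1 z.2)| <= e / 2.
  by have /cvgrPdist_le/(_ _ e20) := cur.
have [[A B] [/= At Bx] AB] := Nz.
exists (A, B) => // -[t' y] /= [At' By].
have H1 := AB (t', y) (conj At' By).
have H2 := AB (t', x) (conj At' (nbhs_singleton Bx)).
rewrite (splitr e) -(subrKA (u (ray t x))) (le_trans (ler_normD _ _))// lerD//.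
by rewrite distrC.
Qed.

Lemma continuous_along_ray u x (m : nat) : {in V, continuous u} -> V x ->
  {within `[0, 1]%classic, continuous (fun t => t ^+ m * u (ray t x))}.
Proof.
move=> cu Vx; apply: continuous_in_subspaceT => t /set_mem t01.
apply: cvgM; first exact: exprn_continuous.
apply: (@continuous_comp _ _ _ (fun t => ray t x) u); last first.
  by apply: cu; rewrite inE; exact: starV.
apply: cvgD; first exact: cvg_cst.
by apply: cvgZr_tmp; exact: cvg_id.
Qed.

Lemma integrable_along_ray u x m : {in V, continuous u} -> V x ->
  mu.-integrable `[0, 1]%classic (EFin \o (fun t => t ^+ m * u (ray t x))).
Proof.
move=> cu Vx; apply: continuous_compact_integrable.
  exact: segment_compact.
exact: continuous_along_ray.
Qed.

(** The weight t^m is what differentiation in x brings out, once for each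
    partial derivative. *)
Definition ray_mean (m : nat) u (x : 'rV[R]_n) : R :=
  \int[mu]_(t in `[0, 1]) (t ^+ m * u (ray t x)).

Lemma ray_mean_continuous m u : open V -> {in V, continuous u} ->
  {in V, continuous (ray_mean m u)}.
Proof.
move=> oV cu x /set_mem Vx.
apply: continuous_distP => e e0.
have NV : \forall y \near x, V y by exact: open_nbhs_nbhs.
apply: filterS2 (ray_uniform cu Vx e0) NV => y uy Vy.
have Iy := integrable_along_ray m cu Vy.
have Ix := integrable_along_ray m cu Vx.
rewrite -RintegralB//.
apply: le_trans (le_normr_Rintegral _ _) _ => //.
  exact: (integrableB _ Ix Iy).
rewrite -[leRHS]Rintegral_unit_cst.
apply: le_Rintegral => //.
- apply: integrable_norm.
  exact: (integrableB _ Ix Iy).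
- apply: continuous_compact_integrable; first exact: segment_compact.
  by move=> t; exact: cst_continuous.
move=> t /[dup] t01; rewrite /= in_itv /= => /andP[t0 t1].
rewrite -mulrBr normrM distrC ger0_norm ?exprn_ge0//.
rewrite (@le_trans _ _ (1 * `|u (ray t y) - u (ray t x)|))//.
  by rewrite ler_wpM2r// exprn_ile1.
by rewrite mul1r; exact: uy.
Qed.

Lemma ray_line t (h : R) x v : ray t (h *: v + x) = (h * t) *: v + ray t x.
Proof. by rewrite /ray -addrA scalerDr addrCA scalerA [t * h]mulrC. Qed.

(** Differentiation under the integral sign. The derivative of the integrand
    is dominated near x thanks to ray_uniform. *)
Lemma is_derive_ray_mean m u x i : open V -> Ck_on 1 V u -> V x ->
  is_derive x (e_ i) (ray_mean m u) (ray_mean m.+1 ('D_(e_ i) u) x).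
Proof.
move=> oV [cu Du] Vx; have [du [cDu _]] := Du i.
pose line h := h *: e_ i + x.
have line_cont : {for 0, continuous line}.
  by apply: cvgD; [apply: cvgZr_tmp; exact: cvg_id|exact: cvg_cst].
have line0 : line 0 = x by rewrite /line scale0r add0r.
have [r /= r0 Hr] : \forall h \near (0 : R), V (line h) /\
    forall t, `[0, 1]%classic t ->
    `|'D_(e_ i) u (ray t (line h)) - 'D_(e_ i) u (ray t x)| <= 1.
  have := line_cont; rewrite /prop_for /continuous_at line0 => lc.
  apply: (lc [set y | V y /\ forall t, `[0, 1]%classic t ->
    `|'D_(e_ i) u (ray t y) - 'D_(e_ i) u (ray t x)| <= 1]).
  have NV : \forall y \near x, V y by exact: open_nbhs_nbhs.
  by apply: filterS2 NV (ray_uniform cDu Vx ltr01) => y.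
have {}Hr h : `]-r, r[%classic h -> V (line h) /\ forall t, `[0, 1]%classic t ->
    `|'D_(e_ i) u (ray t (line h)) - 'D_(e_ i) u (ray t x)| <= 1.
  move=> hr; apply: Hr; rewrite /ball_ /= sub0r normrN ltr_norml.
  by move: hr; rewrite /= in_itv.
pose f h t := t ^+ m * u (ray t (line h)).
have df h t : `]-r, r[%classic h -> `[0, 1]%classic t ->
    is_derive h (1 : R) (f ^~ t) (t ^+ m.+1 * 'D_(e_ i) u (ray t (line h))).
  move=> hr t01; have [Vh _] := Hr h hr.
  have Vth : V ((h * t) *: e_ i + ray t x) by rewrite -ray_line; exact: starV.
  have d1 := @is_derive_line R 'rV[R]_n R^o u (ray t x) (e_ i) (h * t)
    (du _ Vth).
  have d2 : is_derive h (1 : R) (fun h => h * t) t.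
    have := is_deriveM (is_derive_id h 1) (is_derive_cst t h (1 : R)).
    by rewrite scaler0 add0r [_ *: _]mulr1.
  have d3 := @is_derive1_comp R (fun s : R => u (s *: e_ i + ray t x))
    (fun h : R => h * t) h _ _ d1 d2.
  have -> : f ^~ t = cst (t ^+ m) * ((fun s : R => u (s *: e_ i + ray t x)) \o
      (fun h : R => h * t)).
    by apply/funext => s; rewrite fctE /f /= ray_line.
  apply: (is_derive_eq (is_deriveM (is_derive_cst (t ^+ m) h (1 : R)) d3)).
  by rewrite scaler0 addr0 -ray_line exprS /GRing.scale /=; ring.
(* Near x the integrand is within 1 of its value at x. *)
pose G t := `|'D_(e_ i) u (ray t x)| + 1.
have r0' : `]- r, r[%classic (0 : R) by rewrite /= in_itv /= oppr_lt0 r0.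
have d1E h t : `]-r, r[%classic h -> `[0, 1]%classic t ->
    partial1of2 f h t = t ^+ m.+1 * 'D_(e_ i) u (ray t (line h)).
  by move=> hr t01; rewrite partial1of2E; have [_ ->] := df h t hr t01.
have intf h : `]-r, r[%classic h -> mu.-integrable `[0, 1] (EFin \o f h).
  by move=> /Hr[Vh _]; exact: integrable_along_ray.
have intG : mu.-integrable `[0, 1]%classic (EFin \o G).
  have cG : {in V, continuous (fun y => `|'D_(e_ i) u y| + 1)}.
    by move=> y Vy; exact: cvgD (cvg_norm (cDu y Vy)) (cvg_cst _).
  have := integrable_along_ray 0 cG Vx; congr (_.-integrable _ _).
  by apply/funext => t /=; rewrite mul1r.
have G_ub h t : `]-r, r[%classic h -> `[0, 1]%classic t ->
    `|partial1of2 f h t| <= G t.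
  move=> hr t01; rewrite d1E// normrM /G.
  have [_ /(_ t t01) Hu] := Hr h hr.
  move: t01; rewrite /= in_itv /= => /andP[t0 t1].
  rewrite (@le_trans _ _ (1 * `|'D_(e_ i) u (ray t (line h))|))//.
    by rewrite ler_wpM2r// ger0_norm ?exprn_ge0// exprn_ile1.
  rewrite mul1r -lerBlDl (le_trans _ Hu)//.
  exact: lerB_dist.
have := @cvg_differentiation_under_integral R _ _ mu f `[0, 1]%classic
  (measurable_itv _) 0 (- r) r r0' intf
  (fun h t hr t01 => let: DeriveDef d _ := df h t hr t01 in d)
  G (fun t => addr_ge0 (normr_ge0 _) ler01) intG G_ub.
move=> H.
have {}H : h^-1 *: (ray_mean m u (h *: e_ i + x) - ray_mean m u x) @[h --> 0^'] -->
    ray_mean m.+1 ('D_(e_ i) u) x.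
  have E : \int[mu]_(t in `[0, 1]) partial1of2 f 0 t =
      ray_mean m.+1 ('D_(e_ i) u) x.
    rewrite /ray_mean; apply: eq_Rintegral => t /set_mem t01.
    by rewrite d1E// line0.
  move: H; under eq_fun do rewrite addr0.
  by rewrite E /f line0.
apply: DeriveDef; last exact/cvg_lim.
by apply/cvg_ex; eexists; exact: H.
Qed.

Lemma Ck_on_ray_mean k m u : open V -> Ck_on k V u -> Ck_on k V (ray_mean m u).
Proof.
move=> oV; elim: k m u => [|k IHk] m u ku.
  by split=> //; apply: ray_mean_continuous => //; case: ku.
have [cu Du] := ku; split; first exact: ray_mean_continuous.
move=> i.
have dm x : V x -> is_derive x (e_ i) (ray_mean m u) (ray_mean m.+1 ('D_(e_ i) u) x).
  by move=> Vx; apply: is_derive_ray_mean => //; exact: (Ck_on_le (ltn0Sn k)).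
split=> [x /dm[]//|].
have [_ kDu] := Du i.
apply: (Ck_on_ext oV) (IHk m.+1 _ kDu) => x Vx.
by have [_ ->] := dm x Vx.
Qed.

(** The fundamental theorem of calculus along the segment from q to x. *)
Lemma ray_fundamental u x : open V -> Ck_on 1 V u -> V x ->
  u x - u q = \sum_i (x 0 i - q 0 i) * ray_mean 0 ('D_(e_ i) u) x.
Proof.
move=> oV ku Vx.
pose F t := u (ray t x).
pose dF t := \sum_i (x 0 i - q 0 i) * 'D_(e_ i) u (ray t x).
have cD i : {in V, continuous ('D_(e_ i) u)}.
  by have [_ /(_ i)[_ []]] := ku.
have F' (t : R) : `[0, 1]%classic t -> is_derive t (1 : R) F (dF t).
  move=> t01.
  have dr : is_derive t (1 : R) (fun t => ray t x) (x - q).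
    have := @is_derive_line R 'rV[R]_n 'rV[R]_n id q (x - q) t.
    rewrite derive_id => /(_ (@derivable_id _ _ _ _)).
    by congr is_derive; apply/funext => s; rewrite /ray addrC.
  have := @is_derive_comp_Ck_on_1 _ _ R^o (ray ^~ x) V u t 1 _
    oV ku (starV t01 Vx) dr.
  move=> H; apply: (is_derive_eq H); apply: eq_bigr => i _.
  by rewrite !mxE.
have cF (t : R) : `[0, 1]%classic t -> {for t, continuous F}.
  move=> t01; apply/differentiable_continuous/derivable1_diffP.
  by case: (F' t t01).
have cdF i : {within `[0, 1]%classic, continuous (fun t => 'D_(e_ i) u (ray t x))}.
  have := continuous_along_ray (m := 0) (cD i) Vx.
  suff -> : (fun t : R => t ^+ 0 * 'D_(e_ i) u (ray t x)) =
    (fun t => 'D_(e_ i) u (ray t x)) by [].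
  by apply/funext => t; rewrite mul1r.
have [cS intS] := Rintegral_unit_sum (index_enum 'I_n) (fun i => x 0 i - q 0 i) cdF.
have <- : \int[mu]_(t in `[0, 1]) dF t =
    \sum_i (x 0 i - q 0 i) * ray_mean 0 ('D_(e_ i) u) x.
  rewrite intS; apply: eq_bigr => i _; congr (_ * _).
  by apply: eq_Rintegral => t _; rewrite mul1r.
have dFLR : derivable_oo_LRcontinuous F 0 1.
  split.
  - move=> t t01; have [] // := F' t.
    by move: t01; rewrite /= !in_itv /= => /andP[? ?]; rewrite !ltW.
  - apply: cvg_at_right_filter; apply: cF.
    by rewrite /= in_itv /= lexx ler01.
  - apply: cvg_at_left_filter; apply: cF.
    by rewrite /= in_itv /= lexx ler01.
have dFE : {in `]0, 1[, derive1 F =1 dF}.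
  move=> t t01; rewrite derive1E; have [] // := F' t.
  by move: t01; rewrite /= !in_itv /= => /andP[? ?]; rewrite !ltW.
rewrite /Rintegral (continuous_FTC2 ltr01 cS dFLR dFE) /=.
by rewrite /F /ray scale1r scale0r addr0 subrKC.
Qed.

Lemma ray_mean_center u : ray_mean 0 u q = u q.
Proof.
rewrite -[RHS]Rintegral_unit_cst; apply: eq_Rintegral => t _.
by rewrite mul1r /ray subrr scaler0 addr0.
Qed.

End Hadamard.

Theorem hadamard (R : realType) (n : nat) (V : set 'rV[R]_n) (q : 'rV[R]_n)
    (u : 'rV[R]_n -> R) :
  open V -> star_shaped q V -> smooth_on V u -> V q ->
  exists h : 'I_n -> 'rV[R]_n -> R, [/\ forall i, smooth_on V (h i),
    forall i, h i q = 'D_(delta_mx 0 i) u q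
    & forall x, V x -> u x = u q + \sum_i (x 0 i - q 0 i) * h i x].
Proof.
move=> oV starV su Vq; exists (fun i => ray_mean q 0 ('D_(delta_mx 0 i) u)).
split=> [i k|i|x Vx]; last 2 first.
- exact: ray_mean_center.
- by rewrite -(ray_fundamental starV oV (su 1) Vx) subrKC.
apply: (Ck_on_ray_mean starV) => //.
by have [_ /(_ i)[]] := su k.+1.
Qed.

Lemma ball_star_shaped (R : realType) (n : nat) (c q : 'rV[R]_n) (r : R) :
  `|q - c| < r -> star_shaped q [set x | `|x - c| < r].
Proof.
move=> qr t x; rewrite /= in_itv /= => /andP[t0 t1] xr.
have -> : ray q t x - c = (1 - t) *: (q - c) + t *: (x - c).
  by apply/rowP => i; rewrite !mxE; ring.
rewrite (le_lt_trans (ler_normD _ _))// !normrZ.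
rewrite !ger0_norm ?subr_ge0//.
have [->|tn0] := eqVneq t 0; first by rewrite subr0 mul1r mul0r addr0.
have -> : r = (1 - t) * r + t * r by rewrite -mulrDl subrK mul1r.
by rewrite ler_ltD// ?ler_wpM2l ?subr_ge0// ?(ltW qr)// ltr_pM2l// lt0r tn0.
Qed.

(** * The module of vector fields *)

Section SmoothFunctionAlgebra.
Variables (R : realType) (n : nat) (M : manifold R n).
Implicit Types f g : smoothFun M.

Lemma smooth_addE f g m : (f + g) m = f m + g m. Proof. by []. Qed.
Lemma smooth_oppE f m : (- f) m = - f m. Proof. by []. Qed.
Lemma smooth_mulE f g m : (f * g) m = f m * g m. Proof. by []. Qed.
Lemma smooth_scaleE a f m : (a *: f) m = a * f m. Proof. by []. Qed.
Lemma smooth_funP f g : f = g <-> forall m, f m = g m.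
Proof. by split=> [->//|fg]; apply/val_inj/funext. Qed.
Lemma smooth_sumE (I : Type) (s : seq I) (F : I -> smoothFun M) m :
  (\sum_(i <- s) F i) m = \sum_(i <- s) F i m.
Proof. by elim: s => [|i s IHs]; rewrite ?big_nil// !big_cons smooth_addE IHs. Qed.
Lemma vector_addE (X Y : vectorField M) f : (X + Y) f = X f + Y f :> smoothFun M.
Proof. by []. Qed.
Lemma vector_scaleE (h : smoothFun M) (X : vectorField M) f : (h *: X) f = h * X f :> smoothFun M.
Proof. by []. Qed.
Lemma vector_sumE (I : Type) (s : seq I) (F : I -> vectorField M) f :
  (\sum_(i <- s) F i) f = \sum_(i <- s) F i f :> smoothFun M.
Proof. by elim: s => [|i s IHs]; rewrite ?big_nil// !big_cons vector_addE IHs. Qed.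
Lemma vector_fieldP (X Y : vectorField M) : X = Y <-> forall f, X f = Y f.
Proof. by split=> [->//|fg]; apply/val_inj/funext. Qed.

Variable X : vectorField M.

Lemma derivation_add f g : X (f + g) = X f + X g :> smoothFun M.
Proof. by have /asboolP[lX _] := vf_valP X; have := lX 1 f g; rewrite !scale1r. Qed.
Lemma derivation_scale a f : X (a *: f) = a *: X f :> smoothFun M.
Proof.
have /asboolP[lX _] := vf_valP X; have X0 : X 0 = 0 :> smoothFun M.
  by have /eqP := derivation_add 0 0; rewrite addr0 -subr_eq0 opprD addNKr oppr_eq0 => /eqP.
by have := lX a f 0; rewrite X0 !addr0.
Qed.
Lemma derivation_mul f g : X (f * g) = X f * g + f * X g :> smoothFun M.
Proof. by have /asboolP[_ mX] := vf_valP X; exact: mX. Qed.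
Lemma derivation_sum (I : Type) (s : seq I) (F : I -> smoothFun M) :
  X (\sum_(i <- s) F i) = \sum_(i <- s) X (F i) :> smoothFun M.
Proof.
elim: s => [|i s IHs]; last by rewrite !big_cons derivation_add IHs.
by rewrite !big_nil -(scale0r 0) derivation_scale !scale0r.
Qed.

End SmoothFunctionAlgebra.

(** * Smooth functions and vector fields supported in a chart *)

Section ChartExtension.
Variables (R : realType) (n : nat) (M : manifold R n).
Implicit Types (c d : chart R n M) (u : 'rV[R]_n -> R).

Lemma chart_invK c x : (c @` chart_dom c) x -> chart_dom c (chart_inv c x) /\
  c (chart_inv c x) = x.
Proof. by move=> [p cp <-]; rewrite (chart_mapK (mem_set cp)). Qed.

(** The chart inverse is only continuous on the open image of the chart. *)
Lemma open_chart_preimage c (O : set M) : open O ->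
  open [set x | (c @` chart_dom c) x /\ O (chart_inv c x)].
Proof.
move=> oO; rewrite openE => x [cx Ox].
apply: filterI; first exact: open_nbhs_nbhs (conj (chart_cod_open c) cx).
by apply: (chart_inv_cont (mem_set cx)); exact: open_nbhs_nbhs.
Qed.

Definition chart_extension d u (p : M) : R :=
  if p \in chart_dom d then u (d p) else 0.

(** In another chart the extension is locally either u composed with a change
    of coordinates, or 0: the compact set K is closed in the manifold, which is
    where the Hausdorff property matters. *)
Lemma chart_extension_smooth d (K : set 'rV[R]_n) u : atlas d -> compact K ->
  K `<=` d @` chart_dom d -> smooth_on setT u -> (forall x, ~ K x -> u x = 0) ->
  chart_extension d u \in @smooth_pred R n M.
Proof.
move=> ad cK Kd su u0; apply/asboolP => c ac k.
apply: Ck_on_local => _ [p cp <-].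
have [dp|ndp] := pselect (chart_dom d p).
  have oV := open_chart_preimage (c := c) (chart_dom_open d).
  exists [set x | (c @` chart_dom c) x /\ chart_dom d (chart_inv c x)].
    by split; [exists p|rewrite (chart_mapK (mem_set cp))].
  have kdc j := atlas_compatible ac ad j k.
  apply: (Ck_on_ext oV) (Ck_on_comp (c := d \o chart_inv c) oV openT _ _ (su k)) => //.
    by move=> x [_ dx]; rewrite /= /chart_extension mem_set.
  move=> j; apply: Ck_onW (kdc j) => x [[m cm <-]].
  by rewrite (chart_mapK (mem_set cm)) => dm; exists m.
have cC : compact (chart_inv d @` K).
  apply: continuous_compact => //; apply: continuous_in_subspaceT => x /set_mem Kx.
  by apply: chart_inv_cont; rewrite inE; exact: Kd.
have oC : open (~` (chart_inv d @` K)).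
  by apply: closed_openC; exact: compact_closed (@manifold_hausdorff _ _ M) cC.
have oV := open_chart_preimage (c := c) oC.
exists [set x | (c @` chart_dom c) x /\ (~` (chart_inv d @` K)) (chart_inv c x)].
  split; first by exists p.
  rewrite (chart_mapK (mem_set cp)) => -[x Kx xp].
  by apply: ndp; rewrite -xp; have [] := chart_invK (Kd _ Kx).
apply: (Ck_on_ext oV) (Ck_on_cst k _ 0) => x [_ Cx].
rewrite /= /chart_extension; case: ifP => // /set_mem dx.
rewrite u0// => Kx; apply: Cx; exists (d (chart_inv c x)) => //.
by rewrite (chart_mapK (mem_set dx)).
Qed.


End ChartExtension.

Section Cutoff.
Variables (R : realType) (n : nat) (M : manifold R n).
Variables (d : chart R n M) (x0 : 'rV[R]_n) (r : R) (psi : 'rV[R]_n -> R).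
Local Notation B := [set x : 'rV[R]_n | `|x - x0| < r].
Hypotheses (ad : atlas d) (r0 : 0 < r) (Bd : B `<=` d @` chart_dom d).
Hypotheses (spsi : smooth_on setT psi)
  (psi0 : forall x, r / 2 <= `|x - x0| -> psi x = 0).
Implicit Types (h u : 'rV[R]_n -> R).
Local Notation F := (smoothFun M).
Local Notation e_ i := (delta_mx 0 i : 'rV[R]_n).

Lemma dist_continuous : continuous (fun x : 'rV[R]_n => `|x - x0|).
Proof.
move=> x.
have c1 : {for x, continuous (fun y : 'rV[R]_n => y - x0)}.
  by apply: continuousB; [exact: cvg_id|exact: cst_continuous].
exact: (@cvg_norm R 'rV[R]_n _ _ _ _ _ c1).
Qed.

Lemma open_chart_ball : open B.
Proof.
exact: (@open_comp 'rV[R]_n R _ _ (fun x _ => @dist_continuous x) (@open_lt R r)).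
Qed.

Lemma compact_half_ball : compact [set x : 'rV[R]_n | `|x - x0| <= r / 2].
Proof.
apply: bounded_closed_compact.
  exists (`|x0| + r / 2); split; first exact: num_real.
  move=> e re x /= xr; rewrite -(subrK x0 x).
  rewrite (le_trans (ler_normD _ _))// addrC (le_trans _ (ltW re))//.
  by rewrite lerD2l.
exact: (@preimage_closed 'rV[R]_n R _ _ (fun x _ => @dist_continuous x) (@closed_le R (r / 2))).
Qed.

(** Beyond the radius r / 2 the product vanishes, so that the values of h
    outside of the ball of radius r, where it need not be smooth, are
    irrelevant. *)
Lemma cutoff_smooth_on h : smooth_on B h -> smooth_on setT (psi * h).
Proof.
move=> sh k; apply: Ck_on_local => x _.
have [xr|xr] := ltP `|x - x0| r.
  exists B => //; apply: Ck_onM; [exact: open_chart_ball| |exact: sh].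
  by apply: Ck_onW (spsi k).
have oV : open [set x : 'rV[R]_n | r / 2 < `|x - x0|].
  exact: (@open_comp 'rV[R]_n R _ _ (fun x _ => @dist_continuous x) (@open_gt R (r / 2))).
exists [set x : 'rV[R]_n | r / 2 < `|x - x0|].
  by rewrite /= (lt_le_trans _ xr)// ltr_pdivrMr// ltr_pMr// ltr1n.
apply: (Ck_on_ext oV) (Ck_on_cst k _ 0) => y /= ry.
by rewrite fctE psi0 ?mul0r// ltW.
Qed.

Lemma cutoff_subproof h : smooth_on B h ->
  chart_extension d (psi * h) \in @smooth_pred R n M.
Proof.
move=> sh; apply: (chart_extension_smooth ad compact_half_ball).
- move=> x /= xr; apply: Bd; apply: (le_lt_trans xr).
  by rewrite ltr_pdivrMr// ltr_pMr// ltr1n.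
- exact: cutoff_smooth_on.
- move=> x /= /negP; rewrite -ltNge => xr.
  by rewrite fctE psi0 ?mul0r// ltW.
Qed.

Definition cutoff h (sh : smooth_on B h) : F := SmoothFun (cutoff_subproof sh).

(** Identities between products of cut off functions are checked pointwise:
    either at a point q of the ball in R^n, or they are trivial. *)
Variant cutoff_spec (m : M) : Prop :=
  | CutoffIn (q : 'rV[R]_n) of B q & chart_inv d q = m &
     forall h (sh : smooth_on B h), cutoff sh m = psi q * h q
  | CutoffOut of forall h (sh : smooth_on B h), cutoff sh m = 0.

Lemma cutoffP m : cutoff_spec m.
Proof.
have [dm|ndm] := pselect (chart_dom d m); last first.
  apply: CutoffOut => h sh.
  by rewrite /cutoff /= /chart_extension ifF//; apply: memNset.
have [mB|mB] := ltP `|d m - x0| r.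
  apply: (CutoffIn mB); first by rewrite (chart_mapK (mem_set dm)).
  by move=> h sh; rewrite /cutoff /= /chart_extension ifT//; apply: mem_set.
apply: CutoffOut => h sh.
rewrite /cutoff /= /chart_extension ifT; last exact: mem_set.
rewrite fctE psi0 ?mul0r// (le_trans _ mB)//.
by rewrite ler_pdivrMr// ler_pMr// ler1n.
Qed.

Lemma smooth_local_expression (f : F) : smooth_on B (f \o chart_inv d).
Proof.
move=> k; have /asboolP/(_ d ad k) := smooth_valP f.
exact: Ck_onW.
Qed.

Lemma smooth_local_partial (f : F) i :
  smooth_on B ('D_(e_ i) (f \o chart_inv d)).
Proof. by move=> k; have [_ /(_ i)[]] := smooth_local_expression f k.+1. Qed.

(** The derivation psi d/dx_i, defined on the whole manifold. *)
Definition coordinate_derivation i (f : F) : F :=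
  cutoff (smooth_local_partial f i).

Lemma coordinate_derivation_subproof i :
  (coordinate_derivation i : F -> F^o) \in @derivation_pred R n M.
Proof.
have Dv (f : F) q : B q -> derivable (f \o chart_inv d) q (e_ i).
  by move=> Bq; have [_ /(_ i)[Df _]] := smooth_local_expression f 1; exact: Df.
apply/asboolP; split=> [a f h|f h]; apply/smooth_funP => m.
  rewrite smooth_addE smooth_scaleE /coordinate_derivation.
  case: (cutoffP m) => [q Bq _ E|E]; rewrite !E; last by rewrite mulr0 addr0.
  have -> : (a *: f + h : F) \o chart_inv d =
      a *: (f \o chart_inv d) + (h \o chart_inv d).
    by apply/funext => x; rewrite fctE smooth_addE smooth_scaleE.
  have [_ ->] := is_deriveD (is_deriveZ a (derivableP (Dv f q Bq)))
    (derivableP (Dv h q Bq)).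
  by rewrite mulrDr mulrCA.
rewrite smooth_addE !smooth_mulE /coordinate_derivation.
case: (cutoffP m) => [q Bq qm E|E]; rewrite !E; last by rewrite mul0r mulr0 addr0.
have -> : (f * h : F) \o chart_inv d =
    (f \o chart_inv d) * (h \o chart_inv d).
  by apply/funext => x; rewrite fctE smooth_mulE.
have [_ ->] := is_deriveM (derivableP (Dv f q Bq)) (derivableP (Dv h q Bq)).
rewrite /= qm.
rewrite mulrDr [RHS]addrC; congr (_ + _); first exact: mulrCA.
by rewrite [_ *: _]mulrC mulrA.
Qed.

Definition coordinate_field i : vectorField M :=
  VectorField (coordinate_derivation_subproof i).

Lemma smooth_on_one : smooth_on B (cst 1).
Proof. by move=> k; exact: Ck_on_cst. Qed.

Lemma smooth_on_coord (i : 'I_n) : smooth_on B (fun x => x 0 i).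
Proof. by move=> k; exact: Ck_on_coord. Qed.

Definition bump_fun : F := cutoff smooth_on_one.

Definition cutoff_coord i : F := cutoff (smooth_on_coord i).

(** The formula has no denominator and holds everywhere, both sides being zero
    away from the chart ball. Inside, W is applied to the decomposition of
    psi^2 f given by Hadamard's lemma at q; the terms where W acts on the
    factors h_i disappear because the coordinates of q are those of the point
    of evaluation. *)
Lemma derivation_in_coordinates (W : vectorField M) (f : F) :
  bump_fun ^+ 3 * W f = \sum_i (bump_fun * W (cutoff_coord i)
     - cutoff_coord i * W bump_fun) * coordinate_field i f :> F.
Proof.
apply/smooth_funP => m; rewrite smooth_sumE.
case: (cutoffP m) => [q Bq qm E|E]; last first.
  have b0 : bump_fun m = 0 by exact: E.
  rewrite !exprS !smooth_mulE b0 !mul0r big1// => i _.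
  rewrite smooth_mulE; have -> : (coordinate_field i f : F) m = 0 by exact: E.
  by rewrite mulr0.
have [h [sh hq hE]] := hadamard open_chart_ball (ball_star_shaped Bq)
  (smooth_local_expression f) Bq.
have decomposed : bump_fun * bump_fun * f = f m *: (bump_fun * bump_fun) +
   \sum_i (cutoff_coord i - q 0 i *: bump_fun) * cutoff (sh i).
  apply/smooth_funP => m'.
  rewrite smooth_addE smooth_sumE smooth_scaleE !smooth_mulE.
  under eq_bigr do rewrite smooth_mulE smooth_addE smooth_oppE smooth_scaleE.
  rewrite /bump_fun /cutoff_coord.
  case: (cutoffP m') => [q' Bq' qm' E'|E']; last first.
    rewrite E' !mul0r mulr0 add0r big1// => i _.
    by rewrite !E' mulr0.
  rewrite !E'; under eq_bigr do rewrite !E'.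
  have := hE q' Bq'; rewrite /= qm' qm => ->.
  rewrite mulrDr mulr_sumr [f m * _]mulrC; congr (_ + _).
  by apply: eq_bigr => i _; rewrite !mulr1 [q 0 i * _]mulrC -mulrBr mulrACA.
have Ebump : bump_fun m = psi q by rewrite /bump_fun E mulr1.
have Ecoord i : cutoff_coord i m = psi q * q 0 i by rewrite /cutoff_coord E.
have Ecut i : cutoff (sh i) m = (coordinate_field i f : F) m.
  by rewrite -[RHS]/(smooth_val (cutoff (smooth_local_partial f i)) m) !E hq.
have := congr1 (fun g : F => (W g : F) m) decomposed.
have -> : (bump_fun ^+ 3 * W f) m = bump_fun m * (bump_fun m * (bump_fun m * (W f : F) m)).
  by rewrite !exprS expr0 mulr1 !smooth_mulE !mulrA.
move=> WE; have {}WE : bump_fun m * bump_fun m * (W f : F) m =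
    \sum_i (W ((cutoff_coord i - q 0 i *: bump_fun) * cutoff (sh i)) : F) m.
  move: WE; rewrite derivation_mul derivation_add derivation_scale derivation_sum.
  rewrite !smooth_addE smooth_scaleE smooth_sumE !smooth_mulE [f m * _]mulrC.
  by move=> /addrI.
rewrite [bump_fun m * (bump_fun m * (W f : F) m)]mulrA WE mulr_sumr.
apply: eq_bigr => i _.
rewrite derivation_mul derivation_add -scaleNr derivation_scale.
rewrite !smooth_addE !smooth_mulE !smooth_addE !smooth_scaleE smooth_oppE.
rewrite !smooth_mulE Ebump Ecoord -Ecut; ring.
Qed.

End Cutoff.

(** * Tensoriality *)

Section Tensoriality.
Variables (R : realType) (n : nat) (M : manifold R n).
Local Notation F := (smoothFun M).
Local Notation VF := (vectorField M).

(** In derivation_in_coordinates the coefficients are combinations of values of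
    W on functions, and b is the cube of the bump function. *)
Lemma vanishing_field_combination (p : M) :
  exists (b : F) (D : 'I_n -> VF), b p != 0 /\
    forall W : VF, (forall f : F, (W f : F) p = 0) ->
      exists2 a : 'I_n -> F, b *: W = \sum_i a i *: D i & forall i, a i p = 0.
Proof.
have [d ad dp] := atlas_cover p.
have /nbhs_ballP[r /= r0 Hr] : nbhs (d p) (d @` chart_dom d).
  by apply: open_nbhs_nbhs; split; [exact: chart_cod_open|exists p].
have Bd : [set x | `|x - d p| < r] `<=` d @` chart_dom d.
  by move=> x /= xr; apply: Hr; rewrite -ball_normE /= distrC.
have r20 : 0 < r / 2 by rewrite divr_gt0.
have [psi [spsi psip psi0]] := exists_bump (d p) r20.
pose b := bump_fun ad r0 Bd spsi psi0.
pose X := cutoff_coord ad r0 Bd spsi psi0.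
pose D := coordinate_field ad r0 Bd spsi psi0.
exists (b ^+ 3), D; split.
  have bp : b p = psi (d p).
    rewrite /b /bump_fun /= /chart_extension ifT ?fctE ?mulr1//.
    exact: mem_set.
  by rewrite !exprS expr0 mulr1 !smooth_mulE bp !mulf_neq0// gt_eqF.
move=> W Wp; exists (fun i => b * W (X i) - X i * W b).
  apply/vector_fieldP => f; rewrite vector_sumE vector_scaleE.
  exact: derivation_in_coordinates.
by move=> i; rewrite smooth_addE smooth_oppE !smooth_mulE !Wp !mulr0 subr0.
Qed.

Definition function_linear (phi : VF -> F) :=
  forall (f : F) (X Y : VF), phi (f *: X + Y) = f * phi X + phi Y.

Section FunctionLinear.
Variable phi : VF -> F.
Hypothesis lphi : function_linear phi.

Lemma function_linear0 : phi 0 = 0.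
Proof. by have := lphi (-1) 0 0; rewrite scaler0 addr0 mulN1r addNr. Qed.

Lemma function_linearD X Y : phi (X + Y) = phi X + phi Y.
Proof. by have := lphi 1 X Y; rewrite scale1r mul1r. Qed.

Lemma function_linearZ f X : phi (f *: X) = f * phi X.
Proof. by have := lphi f X 0; rewrite function_linear0 !addr0. Qed.

Lemma function_linear_sum (I : Type) (s : seq I) (X : I -> VF) :
  phi (\sum_(i <- s) X i) = \sum_(i <- s) phi (X i).
Proof.
elim: s => [|i s IHs]; first by rewrite !big_nil function_linear0.
by rewrite !big_cons function_linearD IHs.
Qed.

(** Applying phi to b W = sum_i a_i D_i gives b(p) phi(W)(p) = 0, where b(p) is
    not zero. *)
Lemma function_linear_vanish (p : M) (W : VF) :
  (forall f : F, (W f : F) p = 0) -> phi W p = 0.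
Proof.
have [b [D [bp Hb]]] := vanishing_field_combination p.
move=> /Hb[a bW a0].
have : (phi (b *: W)) p = 0.
  rewrite bW function_linear_sum smooth_sumE big1// => i _.
  by rewrite function_linearZ smooth_mulE a0 mul0r.
by rewrite function_linearZ smooth_mulE => /eqP; rewrite mulf_eq0 (negPf bp) => /eqP.
Qed.

(** The components c_i are extended to constant functions, so that X differs
    from the combination of the fields E_i by a field vanishing at p. *)
Lemma function_linear_expansion (p : M) (E : 'I_n -> VF) (c : 'I_n -> R) (X : VF) :
  (forall f : F, (X f : F) p = \sum_i c i * (E i f : F) p) ->
  phi X p = \sum_i c i * phi (E i) p.
Proof.
move=> Xp.
pose Y : VF := \sum_i (c i *: (1 : F)) *: E i.
have : phi (X - Y) p = 0.
  apply: function_linear_vanish => f.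
  rewrite vector_addE smooth_addE Xp.
  have -> : (- Y) f = - (Y f) :> F by [].
  rewrite smooth_oppE vector_sumE smooth_sumE.
  apply/eqP; rewrite subr_eq0; apply/eqP; apply: eq_bigr => i _.
  by rewrite vector_scaleE smooth_mulE smooth_scaleE [(1 : F) p]/(1 : R) mulr1.
rewrite -scaleN1r addrC lphi mulN1r addrC smooth_addE smooth_oppE.
move=> /eqP; rewrite subr_eq0 => /eqP ->.
rewrite function_linear_sum smooth_sumE; apply: eq_bigr => i _.
by rewrite function_linearZ smooth_mulE smooth_scaleE [(1 : F) p]/(1 : R) mulr1.
Qed.

End FunctionLinear.

Variables (g : metric M) (nabla : connection M).

Lemma vector_oppE (X : VF) (f : F) : (- X) f = - X f :> F.
Proof. by []. Qed.

Lemma lie_bracketE (X Y : VF) (f : F) : lie_bracket X Y f = X (Y f) - Y (X f) :> F.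
Proof. by []. Qed.

(** The bracket is not linear over functions; its defect, - (Y f) X, is
    compensated in the curvature by the Leibniz rule for the connection. *)
Lemma lie_bracket_linear (f : F) (X X' Y : VF) :
  lie_bracket (f *: X + X') Y =
    - (Y f : F) *: X + (f *: lie_bracket X Y + lie_bracket X' Y).
Proof.
apply/vector_fieldP => h.
rewrite !(vector_addE, vector_scaleE, lie_bracketE).
by rewrite derivation_add derivation_mul; ring.
Qed.

Lemma connection_oppl X Y : nabla (- X) Y = - nabla X Y.
Proof.
have D0 : nabla 0 Y = 0.
  by have := conn_linearl nabla (-1) 0 0 Y; rewrite scaler0 addr0 scaleN1r addNr.
by have := conn_linearl nabla (-1) X 0 Y; rewrite D0 !addr0 !scaleN1r.
Qed.

Lemma curvature_linear (f : F) (X X' Y Z : VF) :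
  curvature nabla (f *: X + X') Y Z =
    f *: curvature nabla X Y Z + curvature nabla X' Y Z.
Proof.
rewrite /curvature lie_bracket_linear !conn_linearl conn_additiver conn_leibniz.
apply/vector_fieldP => h.
by rewrite !(vector_addE, vector_scaleE, vector_oppE); ring.
Qed.

Lemma curvature_antisym (X Y Z : VF) :
  curvature nabla Y X Z = - curvature nabla X Y Z.
Proof.
rewrite /curvature.
have -> : lie_bracket Y X = - lie_bracket X Y.
  by apply/vector_fieldP => h; rewrite vector_oppE !lie_bracketE opprB.
by rewrite connection_oppl opprK !opprB addrC addrA.
Qed.

(** The second derivatives X (Y f) and Y (X f) of f are cancelled by the bracket
    term, and the first derivatives by antisymmetry in X and Y. *)
Lemma curvature_linear3 (f : F) (X Y Z Z' : VF) :
  curvature nabla X Y (f *: Z + Z') =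
    f *: curvature nabla X Y Z + curvature nabla X Y Z'.
Proof.
rewrite /curvature !(conn_additiver, conn_leibniz).
apply/vector_fieldP => h.
by rewrite !(vector_addE, vector_scaleE, vector_oppE, lie_bracketE); ring.
Qed.

Lemma metric_oppl X Y : g (- X) Y = - g X Y.
Proof.
have := metric_linear g (-1) X 0 Y.
have := metric_linear g (-1) 0 0 Y.
rewrite scaler0 addr0 mulN1r addNr => ->.
by rewrite !addr0 scaleN1r mulN1r.
Qed.

Lemma curvature4_linear2 X Z V :
  function_linear (fun Y => curvature4 g nabla X Y Z V).
Proof.
move=> f Y Y'; rewrite /curvature4 !(curvature_antisym _ X) curvature_linear.
by rewrite !metric_oppl metric_linear mulrN opprD.
Qed.

Lemma curvature4_linear3 X Y V :
  function_linear (fun Z => curvature4 g nabla X Y Z V).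
Proof. by move=> f Z Z'; rewrite /curvature4 curvature_linear3 metric_linear. Qed.

Lemma metric_linear1 Y : function_linear (fun X => g X Y).
Proof. by move=> f X X'; rewrite metric_linear. Qed.

End Tensoriality.

(** * Contraction in an orthonormal basis *)

Section Traces.
Variables (R : realType) (n : nat) (M : manifold R n).
Variables (g : metric M) (nabla : connection M) (p : M).
Local Notation F := (smoothFun M).
Local Notation VF := (vectorField M).
Local Notation E := (frame g p).
Local Notation eps := (causal_sign g p).
Local Notation S := (ricci g nabla).
Local Notation r := (scalar_curvature g nabla).

(** The frame is the zero family at a point without orthonormal basis. There
    the Ricci tensor and the scalar curvature vanish, as the signs do. *)
Variant frame_spec : Prop :=
  | FrameOrthonormal of orthonormal_basis g p E
  | FrameZero of forall i, E i = 0.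

Lemma frameP : frame_spec.
Proof.
have [[E' oE']|noE] := pselect (exists E', orthonormal_basis g p E').
  by apply: FrameOrthonormal; exact: (xgetI _ oE').
apply: FrameZero => i; rewrite /frame xgetPN// => E' oE'.
by apply: noE; exists E'.
Qed.

Lemma ricci_frame0 X Y : (forall i, E i = 0) -> S X Y p = 0.
Proof.
move=> E0; rewrite /ricci big1// => i _; rewrite /causal_sign E0.
by rewrite (function_linear0 (metric_linear1 g 0)) mul0r.
Qed.

Lemma scalar_curvature_frame0 : (forall i, E i = 0) -> r p = 0.
Proof.
by move=> E0; rewrite /scalar_curvature big1// => i _; rewrite ricci_frame0// mulr0.
Qed.

Section OrthonormalFrame.
Hypothesis oE : orthonormal_basis g p E.

Lemma causal_sign_sqr i : eps i * eps i = 1.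
Proof.
have [e1 _ _] := oE; rewrite /causal_sign.
by case: (e1 i) => ->; rewrite ?mul1r// mulrNN mul1r.
Qed.

Lemma metric_frame i j : g (E i) (E j) p = if i == j then eps i else 0.
Proof. by have [_ e0 _] := oE; case: eqVneq => [->//|/e0]. Qed.

(** For a frame vector E_j this contraction uses orthonormality alone; arbitrary
    fields are expanded on the frame only once S is known there. *)
Lemma frame_contraction (t : 'I_n -> R) j :
  \sum_i eps i * (t i * g (E j) (E i) p) = t j.
Proof.
rewrite (bigD1 j)//= big1 ?addr0 => [|i ij]; rewrite metric_frame.
  by rewrite eqxx mulrCA causal_sign_sqr mulr1.
by rewrite eq_sym (negPf ij) !mulr0.
Qed.

Lemma frame_coordinates (X : VF) : exists c : 'I_n -> R, forall phi : VF -> F,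
  function_linear phi -> phi X p = \sum_i c i * phi (E i) p.
Proof.
have [_ _ /(_ X)[c Xc]] := oE.
by exists c => phi lphi; exact: function_linear_expansion.
Qed.

Lemma ricci_expansionl (X Y : VF) (c : 'I_n -> R) :
  (forall phi : VF -> F, function_linear phi ->
    phi X p = \sum_i c i * phi (E i) p) ->
  S X Y p = \sum_i c i * S (E i) Y p.
Proof.
move=> Xc; rewrite /ricci.
under eq_bigr => j _ do rewrite (Xc _ (curvature4_linear2 g nabla _ _ _)) mulr_sumr.
rewrite exchange_big; apply: eq_bigr => i _; rewrite mulr_sumr.
by apply: eq_bigr => j _; rewrite mulrCA.
Qed.

Lemma ricci_expansionr (X Y : VF) (c : 'I_n -> R) :
  (forall phi : VF -> F, function_linear phi ->
    phi Y p = \sum_i c i * phi (E i) p) ->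
  S X Y p = \sum_i c i * S X (E i) p.
Proof.
move=> Xc; rewrite /ricci.
under eq_bigr => j _ do rewrite (Xc _ (curvature4_linear3 g nabla _ _ _)) mulr_sumr.
rewrite exchange_big; apply: eq_bigr => i _; rewrite mulr_sumr.
by apply: eq_bigr => j _; rewrite mulrCA.
Qed.

(** Each sum over the frame is the definition of S or of r, or collapses by
    frame_contraction. *)
Lemma quasi_conformal_trace (a b : R) j k :
  \sum_i eps i * quasi_conformal g nabla a b (E i) (E j) (E k) (E i) p =
  a * S (E j) (E k) p
  + b * ((n%:R - 2) * S (E j) (E k) p + r p * g (E j) (E k) p)
  - r p / n%:R * (a / (n%:R - 1) + 2 * b) * ((n%:R - 1) * g (E j) (E k) p).
Proof.
set kap := r p / n%:R * _.
have term i : eps i * quasi_conformal g nabla a b (E i) (E j) (E k) (E i) p =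
    a * (eps i * curvature4 g nabla (E i) (E j) (E k) (E i) p)
    + b * (S (E j) (E k) p - eps i * (S (E i) (E k) p * g (E j) (E i) p)
       + g (E j) (E k) p * (eps i * S (E i) (E i) p)
       - eps i * (S (E j) (E i) p * g (E k) (E i) p))
    - kap * (g (E j) (E k) p - eps i * (g (E i) (E k) p * g (E j) (E i) p)).
  rewrite /quasi_conformal -/kap (Defs.metric_sym g (E k)) (metric_frame i i) eqxx.
  apply/eqP; rewrite -subr_eq0; apply/eqP.
  (* The two sides agree up to multiples of eps_i^2 - 1 = 0, which come from
     the factors g(E_i, E_i). *)
  transitivity ((eps i * eps i - 1) *
      (b * S (E j) (E k) p - kap * (g (E j) (E k) : F) p)); first by ring.
  by rewrite causal_sign_sqr subrr mul0r.
under eq_bigr do rewrite term.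
rewrite sumrB !big_split /= -!mulr_sumr.
rewrite !(sumrB, big_split) /= !sumr_const card_ord -mulr_sumr.
rewrite (frame_contraction (fun i => S (E i) (E k) p)).
rewrite (frame_contraction (fun i => S (E j) (E i) p)).
rewrite -[\sum_i _ * S _ _ _]/(r p) -[\sum_i _ * _]/(S (E j) (E k) p).
rewrite (frame_contraction (fun i => g (E i) (E k) p)).
rewrite -[S _ _ _ *+ n]mulr_natl -[g _ _ _ *+ n]mulr_natl.
by ring.
Qed.

(** Collecting terms in the trace, its coefficients of S and of - (r / n) g
    are both a + (n - 2) b. *)
Lemma quasi_conformal_flat_frame (a b : R) j k : (2 < n)%N ->
  a + (n%:R - 2) * b != 0 ->
  (forall X Y Z V, quasi_conformal g nabla a b X Y Z V p = 0) ->
  S (E j) (E k) p = r p / n%:R * g (E j) (E k) p.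
Proof.
move=> n2 ab0 flat.
have n0 : n%:R != 0 :> R by rewrite pnatr_eq0 -lt0n; exact: ltn_trans n2.
have n1 : n%:R - 1 != 0 :> R by rewrite subr_eq0 pnatr_eq1 gtn_eqF// (ltn_trans _ n2).
have := quasi_conformal_trace a b j k.
rewrite big1 => [|i _]; last by rewrite flat mulr0.
move=> /esym H; apply: (mulfI ab0); apply/eqP; rewrite -subr_eq0; apply/eqP.
rewrite -H; by field; rewrite n0 n1.
Qed.

End OrthonormalFrame.

Lemma quasi_conformal_flat_einstein (a b : R) (X Y : VF) : (2 < n)%N ->
  a + (n%:R - 2) * b != 0 ->
  (forall X Y Z V, quasi_conformal g nabla a b X Y Z V p = 0) ->
  S X Y p = r p / n%:R * g X Y p.
Proof.
move=> n2 ab0 flat; have [oE|E0] := frameP; last first.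
  by rewrite ricci_frame0// scalar_curvature_frame0// !mul0r.
have [c Xc] := frame_coordinates oE X.
have [c' Yc] := frame_coordinates oE Y.
rewrite (ricci_expansionl _ Xc) (Xc _ (metric_linear1 g Y)) mulr_sumr.
apply: eq_bigr => i _; rewrite (ricci_expansionr _ Yc) mulrCA; congr (_ * _).
rewrite Defs.metric_sym (Yc _ (metric_linear1 g (E i))) mulr_sumr.
apply: eq_bigr => k _; rewrite mulrCA; congr (_ * _).
by rewrite Defs.metric_sym; exact: quasi_conformal_flat_frame flat.
Qed.

End Traces.

(** * Quasi-conformal, conformal and concircular flatness *)

Section CurvatureTensors.
Variables (R : realType) (n : nat) (M : manifold R n).
Variables (g : metric M) (nabla : connection M) (p : M).
Hypothesis n2 : (2 < n)%N.

Let n0 : n%:R != 0 :> R.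
Proof. by rewrite pnatr_eq0 -lt0n; exact: ltn_trans n2. Qed.

Let n1 : n%:R - 1 != 0 :> R.
Proof. by rewrite subr_eq0 pnatr_eq1 gtn_eqF// (ltn_trans _ n2). Qed.

Let n2' : n%:R - 2 != 0 :> R.
Proof. by rewrite subr_eq0 eqr_nat gtn_eqF. Qed.

(** Among Z and C only C has Ricci terms, which fixes its coefficient; that of
    the Riemann tensor then fixes the coefficient of Z, and the terms in r
    happen to match. *)
Lemma quasi_conformalE (a b : R) X Y Z V :
  quasi_conformal g nabla a b X Y Z V p =
    (a + (n%:R - 2) * b) * concircular g nabla X Y Z V p
    - (n%:R - 2) * b * conformal g nabla X Y Z V p.
Proof.
rewrite /quasi_conformal /concircular /conformal; field.
by rewrite n0 n1 n2'.
Qed.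

(** Under the Einstein condition the Ricci terms in C amount to
    (2 r / n) (g(Y,Z) g(X,V) - g(X,Z) g(Y,V)). *)
Lemma conformal_einstein :
  (forall X Y, ricci g nabla X Y p = scalar_curvature g nabla p / n%:R * g X Y p) ->
  forall X Y Z V, conformal g nabla X Y Z V p = concircular g nabla X Y Z V p.
Proof.
move=> SE X Y Z V; rewrite /conformal /concircular !SE; field.
by rewrite n0 n1 n2'.
Qed.

End CurvatureTensors.

Theorem theorem4 (R : realType) (n : nat) (M : manifold R n)
    (g : metric M) (nabla : connection M) (a b : R)
    (hn : (2 < n)%N) (hnabla : metric_connection g nabla)
    (hab : ~ (a = 0 /\ b = 0)) :
  quasi_conformally_flat g nabla a b <->
  [\/ [/\ a + (n%:R - 2) * b = 0, a <> 0, b <> 0 & conformally_flat g nabla],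
      [/\ a + (n%:R - 2) * b <> 0, a <> 0, conformally_flat g nabla
        & concircularly_flat g nabla]
    | [/\ a + (n%:R - 2) * b <> 0, a = 0
        & forall (X Y : vectorField M) (p : M),
            ricci g nabla X Y p
            - scalar_curvature g nabla p / n%:R * g X Y p = 0]].
Proof.
have n2 : n%:R - 2 != 0 :> R by rewrite subr_eq0 eqr_nat gtn_eqF.
split=> [flat|]; last first.
  case=> [[ab0 _ _ C0]|[_ _ C0 Z0]|[_ a0 SE]] X Y Z V p.
  - by rewrite quasi_conformalE// ab0 C0 mul0r mulr0 subrr.
  - by rewrite quasi_conformalE// C0 Z0 !mulr0 subrr.
  - rewrite quasi_conformalE// conformal_einstein// => [|X' Y'].
      by rewrite a0 add0r subrr.
    exact/subr0_eq/SE.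
have [ab0|ab0] := eqVneq (a + (n%:R - 2) * b) 0.
  have b0 : b != 0.
    apply/eqP => b0; apply: hab; split=> //.
    by move: ab0; rewrite b0 mulr0 addr0.
  have a0 : a != 0.
    by apply: contra_neq b0 => a0; move/eqP: ab0;
       rewrite a0 add0r mulf_eq0 (negPf n2) => /eqP.
  constructor 1; split=> //; try exact/eqP.
  move=> X Y Z V p; have := flat X Y Z V p.
  rewrite quasi_conformalE// ab0 mul0r sub0r => /eqP.
  by rewrite oppr_eq0 !mulf_eq0 (negPf n2) (negPf b0) => /eqP.
have SE X Y p : ricci g nabla X Y p = scalar_curvature g nabla p / n%:R * g X Y p.
  by apply: (quasi_conformal_flat_einstein _ _ hn ab0) => *; exact: flat.
have [a0|a0] := eqVneq a 0.
  constructor 3; split=> //; first exact/eqP.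
  by move=> X Y p; rewrite SE subrr.
have Z0 : concircularly_flat g nabla.
  move=> X Y Z V p; have := flat X Y Z V p.
  rewrite quasi_conformalE// conformal_einstein// -mulrBl addrK => /eqP.
  by rewrite mulf_eq0 (negPf a0) => /eqP.
constructor 2; split=> //; try exact/eqP.
by move=> X Y Z V p; rewrite conformal_einstein.
Qed.
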